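(* The free $2$-dendriform algebra on one generator $D^{(2)}$ has as series of dimensions the series of Fuss-Catalan numbers, i.e. $\dim D^{(2)}_n=C^{(2)}_n=\frac{1}{2n+1}\binom{3n}{n}$ for all $n\ge1$, and the $2$-dendriform algebra $Dp^{(2)}$, defined as the $2$-dendriform subalgebra of ${}^2\mathbf{FQSym}$ generated by $\mathbf{F}_{11}$, is free and isomorphic to $D^{(2)}$.
   Context: All vector spaces are over a field $\mathbb{K}$ of characteristic $0$. **$2$-dendriform algebras.** A $2$-dendriform algebra is a vector space with three binary bilinear operations $\prec,\circ,\succ$ such that, with $*=\prec+\circ+\succ$, for all elements $u,v,w$: $(u\prec v)\prec w=u\prec(v*w)$; $(u\circ v)\prec w=u\circ(v\prec w)$; $(u\succ v)\prec w=u\succ(v\prec w)$; $(u\prec v)\circ w=u\circ(v\circ w+v\succ w)$; $(u\circ v+u\succ v)\circ w=u\succ(v\circ w)$; $(u*v)\succ w=u\succ(v\succ w)$. $D^{(2)}$ is the free $2$-dendriform algebra on one generator, and $D^{(2)}_n$ is its homogeneous component of degree $n$ (spanned by the monomials in which the generator occurs $n$ times). **The algebra ${}^2\mathbf{FQSym}$.** A $2$-permutation (of size $n\ge1$) is a word of length $2n$ in which each integer from $1$ to $n$ appears exactly twice. ${}^2\mathbf{FQSym}$ has basis $(\mathbf{F}_\sigma)$ indexed by $2$-permutations, with product $\mathbf{F}_\sigma\mathbf{F}_\tau=\sum_\gamma\mathbf{F}_\gamma$, where $\gamma$ runs over the shifted shuffle of $\sigma$ and $\tau$: all shuffles of $\sigma$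 with the word $\tau[\max\sigma]$ obtained by adding the maximal letter of $\sigma$ to each letter of $\tau$. For a word $\tau=\tau_1\cdots\tau_p$, a right-to-left minimum is a position $i\in[1,p]$ such that $\tau_j\ge\tau_i$ for all $j>i$; let $m_1(\tau)=p$ be the largest such position and $m_2(\tau)$ the second largest (it exists for any $2$-permutation). The three operations on ${}^2\mathbf{FQSym}$ are defined by letting $\mathbf{F}_\sigma\prec\mathbf{F}_\tau$ (resp. $\mathbf{F}_\sigma\circ\mathbf{F}_\tau$, resp. $\mathbf{F}_\sigma\succ\mathbf{F}_\tau$) be the sum of the $\mathbf{F}_\gamma$ over those $\gamma$ in the shifted shuffle of $\sigma$ and $\tau$ in which the last letter of $\sigma$ is to the right of the letter coming from position $m_1(\tau)$ of $\tau$ (resp. between the letters coming from positions $m_2(\tau)$ and $m_1(\tau)$, resp. to the left of the letter coming from position $m_2(\tau)$). These operations make ${}^2\mathbf{FQSym}$ a $2$-dendriform algebra. *)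

(* Defs.v *)
From HB Require Import structures.
From mathcomp Require Import all_boot all_order all_algebra.
From mathcomp Require Import zify finmap boolp monalg.

Set Implicit Arguments.
Unset Strict Implicit.
Unset Printing Implicit Defensive.

Import GRing.Theory.
Local Open Scope ring_scope.

Inductive lin_span (K : fieldType) (V : lmodType K) (S : V -> Prop) :
    V -> Prop :=
| lin_span0 : lin_span S 0
| lin_spanD a u v : S u -> lin_span S v -> lin_span S (a *: u + v).

(* [S] is a subspace of [V] that has a basis with [d] elements. *)
Definition has_dim (K : fieldType) (V : lmodType K) (S : V -> Prop) (d : nat) :=
  exists e : 'I_d -> V,
    (forall c : 'I_d -> K, \sum_i c i *: e i = 0 -> forall i, c i = 0) /\
    (forall v, S v <-> exists c : 'I_d -> K, v = \sum_i c i *: e i).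

(* A vector space with three binary operations and no axiom; it is a
   2-dendriform algebra when it satisfies [is_dend2] below. *)
Record triop (K : fieldType) := Triop {
  triop_sort :> lmodType K;
  prec : triop_sort -> triop_sort -> triop_sort;
  circ : triop_sort -> triop_sort -> triop_sort;
  succ : triop_sort -> triop_sort -> triop_sort }.

Declare Scope dend_scope.
Delimit Scope dend_scope with dend.
Notation "u \prec v" := (prec u v) (at level 40, v at next level) : dend_scope.
Notation "u \circ v" := (circ u v) (at level 40, v at next level) : dend_scope.
Notation "u \succ v" := (succ u v) (at level 40, v at next level) : dend_scope.
Notation "u \star v" := (prec u v + circ u v + succ u v)
  (at level 40, v at next level) : dend_scope.
Local Open Scope dend_scope.

Record is_dend2 (K : fieldType) (A : triop K) : Prop := IsDend2 {
  prec_bilinear : bilinear_for *:%R *:%R (@prec K A);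
  circ_bilinear : bilinear_for *:%R *:%R (@circ K A);
  succ_bilinear : bilinear_for *:%R *:%R (@succ K A);
  dend2_pp : forall u v w : A, (u \prec v) \prec w = u \prec (v \star w);
  dend2_cp : forall u v w : A, (u \circ v) \prec w = u \circ (v \prec w);
  dend2_sp : forall u v w : A, (u \succ v) \prec w = u \succ (v \prec w);
  dend2_pc : forall u v w : A,
    (u \prec v) \circ w = u \circ (v \circ w + v \succ w);
  dend2_cc : forall u v w : A,
    (u \circ v + u \succ v) \circ w = u \succ (v \circ w);
  dend2_ss : forall u v w : A, (u \star v) \succ w = u \succ (v \succ w) }.

Record is_dend2_hom (K : fieldType) (A B : triop K) (f : A -> B) : Prop :=
  IsDend2Hom {
  dend2_hom_linear : linear f;
  dend2_hom_prec : {morph f : u v / u \prec v};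
  dend2_hom_circ : {morph f : u v / u \circ v};
  dend2_hom_succ : {morph f : u v / u \succ v} }.

Definition dend2_isomorphic (K : fieldType) (A B : triop K) : Prop :=
  exists f : A -> B, is_dend2_hom f /\ bijective f.

Definition is_free_dend2 (K : fieldType) (A : triop K) (x : A) : Prop :=
  is_dend2 A /\
  forall (B : triop K) (b : B), is_dend2 B ->
    exists f : A -> B, [/\ is_dend2_hom f, f x = b &
      forall g : A -> B, is_dend2_hom g -> g x = b -> g =1 f].

(* [dend_monomial x n u]: [u] is the value of some monomial in which the
   generator [x] occurs [n] times. *)
Inductive dend_monomial (K : fieldType) (A : triop K) (x : A) :
    nat -> A -> Prop :=
| dend_monomial_gen : dend_monomial x 1 x
| dend_monomial_prec m n u v : dend_monomial x m u -> dend_monomial x n v ->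
    dend_monomial x (m + n) (u \prec v)
| dend_monomial_circ m n u v : dend_monomial x m u -> dend_monomial x n v ->
    dend_monomial x (m + n) (u \circ v)
| dend_monomial_succ m n u v : dend_monomial x m u -> dend_monomial x n v ->
    dend_monomial x (m + n) (u \succ v).

Definition homogeneous (K : fieldType) (A : triop K) (x : A) (n : nat) :
    A -> Prop :=
  lin_span (dend_monomial x n).

Inductive in_subalg (K : fieldType) (A : triop K) (x : A) : A -> Prop :=
| in_subalg_gen : in_subalg x x
| in_subalg0 : in_subalg x 0
| in_subalg_lin a u v :
    in_subalg x u -> in_subalg x v -> in_subalg x (a *: u + v)
| in_subalg_prec u v :
    in_subalg x u -> in_subalg x v -> in_subalg x (u \prec v)
| in_subalg_circ u v :
    in_subalg x u -> in_subalg x v -> in_subalg x (u \circ v)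
| in_subalg_succ u v :
    in_subalg x u -> in_subalg x v -> in_subalg x (u \succ v).

Section GeneratedSubalgebra.
Variables (K : fieldType) (A : triop K) (x : A).

Definition subalg_pred : {pred A} := fun u => `[< in_subalg x u >].

Lemma subalg_predP u : reflect (in_subalg x u) (u \in subalg_pred).
Proof. exact: asboolP. Qed.

Fact subalg_submod_closed : submod_closed subalg_pred.
Proof.
split=> [|a u v /subalg_predP xu /subalg_predP xv]; apply/subalg_predP.
  exact: in_subalg0.
exact: in_subalg_lin.
Qed.

HB.instance Definition _ :=
  GRing.isSubmodClosed.Build K A subalg_pred subalg_submod_closed.

Record subalg_sort := SubalgElt {
  subalg_val : A;
  subalg_valP : subalg_val \in subalg_pred }.

HB.instance Definition _ := [isSub for subalg_val].
HB.instance Definition _ := [Choice of subalg_sort by <:].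
HB.instance Definition _ := [SubChoice_isSubLmodule of subalg_sort by <:].

Definition subalg_gen : subalg_sort :=
  SubalgElt (introT (subalg_predP x) (in_subalg_gen x)).

Fact subalg_op_subproof (op : A -> A -> A) (u v : subalg_sort) :
  (forall a b, in_subalg x a -> in_subalg x b -> in_subalg x (op a b)) ->
  op (val u) (val v) \in subalg_pred.
Proof.
by move=> opP; apply/subalg_predP; apply: opP; apply/subalg_predP/valP.
Qed.

Definition subalg : triop K := @Triop K subalg_sort
  (fun u v => SubalgElt (subalg_op_subproof u v (@in_subalg_prec K A x)))
  (fun u v => SubalgElt (subalg_op_subproof u v (@in_subalg_circ K A x)))
  (fun u v => SubalgElt (subalg_op_subproof u v (@in_subalg_succ K A x))).

End GeneratedSubalgebra.

Definition is_perm2 (w : seq nat) : bool :=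
  let n := (size w)./2 in
  (0 < n)%N && perm_eq w (iota 1 n ++ iota 1 n).

Record perm2 := Perm2 { perm2_word :> seq nat; _ : is_perm2 perm2_word }.

HB.instance Definition _ := [isSub for perm2_word].
HB.instance Definition _ := [Choice of perm2 by <:].

Definition max_letter (w : seq nat) : nat := \max_(i <- w) i.

Definition shift (s t : seq nat) : seq nat :=
  [seq (i + max_letter s)%N | i <- t].

(* A shuffle of two words of lengths [p] and [q] is encoded by a mask: the
   positions of the shuffle where the mask is true hold the letters of the
   first word, in order, and the other positions those of the second word. *)
Definition shuffle_mask (p q : nat) : finType :=
  {m : (p + q).-tuple bool | count id m == p}.

Fixpoint interleave (T : Type) (m : bitseq) (u v : seq T) : seq T :=
  match m, u, v with
  | true :: m', a :: u', _ => a :: interleave m' u' v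
  | false :: m', _, b :: v' => b :: interleave m' u v'
  | _, _, _ => [::]
  end.

Lemma perm_interleave (T : eqType) (m : bitseq) (u v : seq T) :
  count id m = size u -> size m = (size u + size v)%N ->
  perm_eq (interleave m u v) (u ++ v).
Proof.
elim: m u v => [|[] m IHm] u v.
- by case: u => [|a u] //=; case: v.
- case: u => [|a u] //=; rewrite add1n => -[hc] [hs].
  by rewrite perm_cons IHm.
- case: v => [|b v] /=; rewrite add0n ?addn0 ?addnS => hc.
    by move=> hs; move: (count_size id m); rewrite hc -hs ltnn.
  case=> hs; rewrite perm_sym perm_catC /= perm_cons perm_catC perm_sym.
  exact: IHm.
Qed.

Lemma max_letter_perm2 (w : seq nat) :
  is_perm2 w -> max_letter w = (size w)./2.
Proof.
case/andP=> n0 Hw; rewrite /max_letter (perm_big _ Hw) big_cat /= maxnn.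
apply/eqP; rewrite eqn_leq; apply/andP; split.
  by apply/bigmax_leqP_seq => i; rewrite mem_iota; lia.
by apply: (@leq_bigmax_seq _ _ xpredT id) => //; rewrite mem_iota; lia.
Qed.

Lemma size_perm2 (w : seq nat) : is_perm2 w -> size w = (size w)./2.*2.
Proof. by case/andP=> _ /perm_size; rewrite size_cat size_iota addnn. Qed.

Lemma interleave_perm2 (s t : perm2) (m : shuffle_mask (size s) (size t)) :
  is_perm2 (interleave (val m) s (shift s t)).
Proof.
have hs := valP s; have ht := valP t; rewrite /= in hs ht.
have Hm : perm_eq (interleave (val m) s (shift s t)) (s ++ shift s t).
  apply: perm_interleave; first exact/eqP/(valP m).
  by rewrite size_tuple size_map.
have [es et] := (size_perm2 hs, size_perm2 ht).
have sz : (size (interleave (val m) s (shift s t)))./2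
            = ((size s)./2 + (size t)./2)%N.
  by rewrite (perm_size Hm) size_cat size_map {1}es {1}et -doubleD doubleK.
rewrite /is_perm2 sz; move: (hs) (ht) => /andP[s0 Ps] /andP[t0 Pt].
apply/andP; split; first by lia.
apply: perm_trans Hm _; rewrite /shift max_letter_perm2 // iotaD.
set p := (size s)./2 in Ps *; set q := (size t)./2 in Pt *.
have -> : iota (1 + p) q = [seq (i + p)%N | i <- iota 1 q].
  by rewrite addnC iotaDl; apply: eq_map => i; rewrite addnC.
rewrite perm_sym perm_catACA perm_sym perm_cat //.
by rewrite -map_cat perm_map.
Qed.

(* Position in the shuffle [m] of the letter coming from position [i] of the
   first, respectively the second, word. Positions are counted from 0. *)
Definition posl (m : bitseq) (i : nat) : nat :=
  nth 0%N [seq k <- iota 0 (size m) | nth false m k] i.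
Definition posr (m : bitseq) (i : nat) : nat :=
  nth 0%N [seq k <- iota 0 (size m) | ~~ nth false m k] i.

Definition rl_minima (w : seq nat) : seq nat :=
  [seq i <- iota 0 (size w) | all (leq (nth 0%N w i)) (drop i.+1 w)].

Definition m1 (w : seq nat) : nat := nth 0%N (rev (rl_minima w)) 0.
Definition m2 (w : seq nat) : nat := nth 0%N (rev (rl_minima w)) 1.

Section FQSym2.
Variable K : fieldType.

Local Notation FQ := {malg K[perm2]}.

(* The sum of the F_gamma over the shifted shuffles of [s] and [t] whose
   mask satisfies [P]. *)
Definition shuffle_sum (P : perm2 -> perm2 -> pred bitseq) (s t : perm2) : FQ :=
  \sum_(m : shuffle_mask (size s) (size t) | P s t (val m))
    << Perm2 (interleave_perm2 m) >>.

Definition prec_cond (s t : perm2) (m : bitseq) : bool :=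
  (posr m (m1 t) < posl m (size s).-1)%N.
Definition circ_cond (s t : perm2) (m : bitseq) : bool :=
  (posr m (m2 t) < posl m (size s).-1 < posr m (m1 t))%N.
Definition succ_cond (s t : perm2) (m : bitseq) : bool :=
  (posl m (size s).-1 < posr m (m2 t))%N.

Definition bilinear_ext (op : perm2 -> perm2 -> FQ) (x y : FQ) : FQ :=
  \sum_(s <- msupp x) \sum_(t <- msupp y) (x@_s * y@_t) *: op s t.

Definition fqsym2 : triop K := @Triop K FQ
  (bilinear_ext (shuffle_sum prec_cond))
  (bilinear_ext (shuffle_sum circ_cond))
  (bilinear_ext (shuffle_sum succ_cond)).

Definition perm2_11 : perm2 := @Perm2 [:: 1%N; 1%N] isT.

Definition F11 : fqsym2 := (<< perm2_11 >> : FQ).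

Definition Dp2 : triop K := subalg F11.

Definition Dp2_gen : Dp2 := subalg_gen F11.

End FQSym2.

Definition fuss_catalan2 (n : nat) : nat := 'C(3 * n, n) %/ (2 * n).+1.

(* The division above is exact. *)
Lemma fuss_catalan2E (n : nat) :
  ((2 * n).+1 * fuss_catalan2 n)%N = 'C(3 * n, n).
Proof.
rewrite /fuss_catalan2 mulnC divnK //; case: n => // n.
have e := mul_bin_left (3 * n.+1) n.
have cop : coprime (2 * n.+1).+1 n.+1.
  by rewrite coprime_sym /coprime -[(2 * n.+1).+1]addn1 gcdnMDl gcdn1.
rewrite -(Gauss_dvdr _ cop) e; apply: dvdn_mulr.
by have -> : (3 * n.+1 - n = (2 * n.+1).+1)%N by lia.
Qed.

(* Main.v *)
Require Import Defs.
From HB Require Import structures.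
From mathcomp Require Import all_boot all_order all_algebra.
From mathcomp Require Import zify ring finmap boolp monalg.

(** In a 2-dendriform algebra generated by [x], the relations allow one to write
    every element as a combination of the normal forms
    [T1 \circ (T2 \succ (x \prec T3))], where each [Ti] is empty or again a
    normal form; hence ternary trees with [n] nodes span the degree [n], and
    they are counted by the Fuss-Catalan numbers.

    In 2FQSym, let [p] be the last letter of a word [w] and [q] the letter at
    its position [m2]. Cutting [w] into its letters at most [a] and its letters
    larger than [a], the word [w] occurs in the [\prec]-product of the two parts
    iff [p <= a], in their [\circ]-product iff [q <= a < p], and in their
    [\succ]-product iff [a < q]. With this dual description the 2-dendriform relations become
    inequalities between [p], [q] and two cuts [a < b], and the normal forms
    evaluated at [F11] are triangular with respect to suitable words, hence
    independent. As the rewriting of a product of normal forms into normal forms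
    is the same in all 2-dendriform algebras, the subalgebra generated by [F11]
    is free, and every free algebra inherits its basis of trees. *)

Set Implicit Arguments.
Unset Strict Implicit.
Unset Printing Implicit Defensive.

Import GRing.Theory.

(** * Ternary trees *)

Inductive tree := Leaf | Node of tree & tree & tree.

HB.instance Definition _ := gen_eqMixin tree.

Definition is_leaf (T : tree) : bool := if T is Leaf then true else false.

Fixpoint nodes (T : tree) : nat :=
  if T is Node A B C then (nodes A + nodes B + nodes C).+1 else 0.

Lemma nodes_eq0 T : (nodes T == 0) = is_leaf T.
Proof. by case: T. Qed.

Lemma eq_leaf T : (T == Leaf) = is_leaf T.
Proof. by case: T => [|A B C]; [rewrite eqxx | apply/eqP]. Qed.

Definition graft (f : seq tree) : seq tree :=
  if f is A :: B :: C :: f' then Node A B C :: f' else [::].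

(* The forests of [r] trees with [n] nodes. The recursion, on whether the
   first tree is a leaf, is that of the closed form [r / (3n + r) C(3n + r, n)],
   so that no convolution is needed to count ternary trees. *)
Fixpoint forests (n : nat) : nat -> seq (seq tree) :=
  fix forests_n r :=
    if r is r'.+1 then
      [seq Leaf :: f | f <- forests_n r'] ++
      (if n is n'.+1 then [seq graft f | f <- forests n' r.+2] else [::])
    else if n is 0 then [:: [::]] else [::].

Lemma forestsS n r : forests n.+1 r.+1 =
  [seq Leaf :: f | f <- forests n.+1 r] ++ [seq graft f | f <- forests n r.+3].
Proof. by []. Qed.

Lemma mem_forests n r f :
  (f \in forests n r) = (size f == r) && (sumn (map nodes f) == n).
Proof.
elim: n r f => [|n IHn]; elim=> [|r IHr] f.
- by case: f.
- rewrite /= cats0; apply/mapP/idP => [[g] | ].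
    by rewrite -/(forests 0 r) IHr => /andP[/eqP sg sn] ->; rewrite /= sg eqxx.
  case: f => [|[|A B C] f] //= h; last by move: h; lia.
  by exists f; rewrite // -/(forests 0 r) IHr.
- by case: f.
rewrite forestsS mem_cat; apply/orP/idP.
  case=> /mapP[g]; rewrite ?IHr ?IHn.
    by move=> /andP[/eqP sg sn] ->; rewrite /= sg eqxx.
  case: g => [|A [|B [|C g]]] //= /andP[h1 h2] -> /=.
  by apply/andP; split; lia.
case: f => [|[|A B C] f] //= h; [left | right]; apply/mapP.
  by exists f => //; rewrite IHr.
by exists [:: A, B, C & f] => //; rewrite IHn /=; lia.
Qed.

Lemma uniq_forests n r : uniq (forests n r).
Proof.
elim: n r => [|n IHn]; elim=> [|r IHr] //.
  by rewrite /= cats0 map_inj_uniq // => f g [].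
rewrite forestsS cat_uniq map_inj_uniq ?IHr => [|f g []] //=.
rewrite map_inj_in_uniq ?IHn ?andbT => [|f g].
  apply/hasPn => f /mapP[g]; rewrite mem_forests => /andP[/eqP].
  by case: g => [|A [|B [|C g]]] //= _ _ ->; apply/mapP=> -[].
rewrite !mem_forests => /andP[/eqP + _] /andP[/eqP + _].
case: f g => [|A [|B [|C f]]] // [|A' [|B' [|C' g]]] //=.
by move=> _ _ [-> -> -> ->].
Qed.

(** With $N = 3(n+1)+r$, the two branches of [forests] have $\frac rN\binom N{n+1}$ and
    $\frac{r+3}N\binom Nn$ elements by induction. Pascal's rule and $(n+1)\binom N{n+1}=(N-n)\binom
    Nn$ add them up to $\frac{r+1}{N+1}\binom{N+1}{n+1}$. *)
Lemma size_forests n r :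
  (3 * n + r) * size (forests n r) = r * 'C(3 * n + r, n).
Proof.
elim: n r => [|n IHn]; elim=> [|r IHr] //.
- by rewrite bin0; congr (_ * _); elim: r.+1 => //= k; rewrite cats0 size_map.
- by rewrite muln0.
rewrite forestsS size_cat !size_map.
have [N0 eN] : 0 < 3 * n.+1 + r /\ 3 * n + r.+3 = 3 * n.+1 + r by lia.
have := IHn r.+3; rewrite eN; move: IHr.
have := mul_bin_left (3 * n.+1 + r) n.
rewrite addnS binS.
set s1 := size _; set s2 := size _; set c1 := 'C(_, n.+1); set c0 := 'C(_, n).
have -> : 3 * n.+1 + r - n = 2 * n + 3 + r by lia.
move=> h0 h1 h2; apply/eqP; rewrite -(eqn_pmul2l N0); apply/eqP.
have -> : (3 * n.+1 + r) * ((3 * n.+1 + r).+1 * (s1 + s2)) =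
  (3 * n.+1 + r).+1 * ((3 * n.+1 + r) * s1 + (3 * n.+1 + r) * s2) by ring.
(* The two sides differ only by trading three times one member of [h0] for three times the other;
   adding a member on both sides avoids a subtraction in the naturals. *)
rewrite h1 h2; apply/eqP; rewrite -(eqn_add2r (3 * (n.+1 * c1))) {2}h0.
by apply/eqP; ring.
Qed.

Definition trees n : seq tree := map (head Leaf) (forests n 1).

Lemma mem_trees n T : (T \in trees n) = (nodes T == n).
Proof.
apply/mapP/eqP => [[f] | <-].
  rewrite mem_forests; case: f => [|A [|]] //=; rewrite addn0.
  by move=> /eqP sA ->.
by exists [:: T] => //; rewrite mem_forests /= addn0 !eqxx.
Qed.

Lemma uniq_trees n : uniq (trees n).
Proof.
rewrite map_inj_in_uniq ?uniq_forests // => f g; rewrite !mem_forests.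
by case: f g => [|A [|? ?]] // [|B [|? ?]] //= _ _ ->.
Qed.

(** Forests of one tree number $\frac1{3n+1}\binom{3n+1}n$, and
    $(2n+1)\binom{3n+1}n=(3n+1)\binom{3n}n$. *)
Lemma size_trees n : size (trees n) = fuss_catalan2 n.
Proof.
apply/eqP; rewrite size_map -(@eqn_pmul2l (2 * n).+1) //; apply/eqP.
rewrite fuss_catalan2E.
have := size_forests n 1; rewrite addn1 mul1n.
have := mul_bin_down (3 * n).+1 n; rewrite /=.
have -> : (3 * n).+1 - n = (2 * n).+1 by lia.
move=> e1 e2; apply/eqP; rewrite -(@eqn_pmul2l (3 * n).+1) //; apply/eqP.
by rewrite e1 -e2 mulnCA.
Qed.

(** * Normal forms in 2-dendriform algebras *)

Local Open Scope ring_scope.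
Local Open Scope dend_scope.

Inductive kind := Prec | Circ | Succ.

Definition opk (K : fieldType) (A : triop K) (k : kind) : A -> A -> A :=
  match k with Prec => @prec K A | Circ => @circ K A | Succ => @succ K A end.

Section Bilinear.
Variables (K : fieldType) (A : triop K).
Hypothesis dendA : is_dend2 A.

Lemma opk_bilinear k : bilinear_for *:%R *:%R (@opk K A k).
Proof. by case: dendA; case: k. Qed.

Lemma opkDl k a u u' v :
  opk k (a *: u + u' : A) v = a *: opk k u v + opk k u' v.
Proof. exact: (opk_bilinear k).1. Qed.

Lemma opkDr k a u v v' :
  opk k (u : A) (a *: v + v') = a *: opk k u v + opk k u v'.
Proof. exact: (opk_bilinear k).2. Qed.

Lemma precDl a u u' v :
  (a *: u + u' : A) \prec v = a *: (u \prec v) + u' \prec v.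
Proof. exact: (opkDl Prec). Qed.

Lemma precDr a u v v' :
  (u : A) \prec (a *: v + v') = a *: (u \prec v) + u \prec v'.
Proof. exact: (opkDr Prec). Qed.

Lemma circDl a u u' v :
  (a *: u + u' : A) \circ v = a *: (u \circ v) + u' \circ v.
Proof. exact: (opkDl Circ). Qed.

Lemma circDr a u v v' :
  (u : A) \circ (a *: v + v') = a *: (u \circ v) + u \circ v'.
Proof. exact: (opkDr Circ). Qed.

Lemma succDl a u u' v :
  (a *: u + u' : A) \succ v = a *: (u \succ v) + u' \succ v.
Proof. exact: (opkDl Succ). Qed.

Lemma succDr a u v v' :
  (u : A) \succ (a *: v + v') = a *: (u \succ v) + u \succ v'.
Proof. exact: (opkDr Succ). Qed.

Lemma circDr1 u v v' : (u : A) \circ (v + v') = u \circ v + u \circ v'.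
Proof. by have := circDr 1 u v v'; rewrite !scale1r. Qed.

Lemma opk0l k v : opk k (0 : A) v = 0.
Proof.
by have := opkDl k (-1) 0 0 v; rewrite scaler0 addr0 scaleN1r addNr.
Qed.

Lemma opk0r k u : opk k u (0 : A) = 0.
Proof.
by have := opkDr k (-1) u 0 0; rewrite scaler0 addr0 scaleN1r addNr.
Qed.

End Bilinear.

(* [ev x (Node T1 T2 T3)] is [T1 \circ (T2 \succ (x \prec T3))], with the
   leaves erased. (The elements [T1 \succ (T2 \circ (x \prec T3))] would not do:
   they are dependent in degree 3.) *)
Section Evaluation.
Variables (K : fieldType) (A : triop K) (x : A).

Fixpoint ev (T : tree) : A :=
  if T is Node T1 T2 T3 then
    let y := if is_leaf T3 then x else x \prec ev T3 in
    let z := if is_leaf T2 then y else ev T2 \succ y in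
    if is_leaf T1 then z else ev T1 \circ z
  else 0.

(** The three layers of a normal form. An empty tree acts as a unit in them; the value 0 of [ev] at
    a leaf is a default that never enters. *)
Definition oprec T := if is_leaf T then x else x \prec ev T.
Definition osucc T y := if is_leaf T then y else ev T \succ y.
Definition ocirc T y := if is_leaf T then y else ev T \circ y.

Lemma ev_node T1 T2 T3 : ev (Node T1 T2 T3) = ocirc T1 (osucc T2 (oprec T3)).
Proof. by []. Qed.

Section Nodes.
Hypothesis dendA : is_dend2 A.

Lemma ocirc_lin T a u v : ocirc T (a *: u + v) = a *: ocirc T u + ocirc T v.
Proof. by rewrite /ocirc; case: ifP => // _; rewrite (circDr dendA). Qed.

Lemma osucc_lin T a u v : osucc T (a *: u + v) = a *: osucc T u + osucc T v.
Proof. by rewrite /osucc; case: ifP => // _; rewrite (succDr dendA). Qed.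

(** [dend2_cp] and [dend2_sp] carry the factor [w] past [T1] and [T2], then [dend2_pp] merges it
    with [T3]. *)
Lemma prec_node T1 T2 T3 w : ev (Node T1 T2 T3) \prec w =
  ocirc T1 (osucc T2 (x \prec (if is_leaf T3 then w else ev T3 \star w))).
Proof.
rewrite ev_node /ocirc /osucc /oprec; case: (is_leaf T1); case: (is_leaf T2);
  rewrite ?(dend2_cp dendA) ?(dend2_sp dendA);
  by case: (is_leaf T3); rewrite ?(dend2_pp dendA).
Qed.

End Nodes.

(** Formal combinations are plain lists, with repetitions and leaves allowed, so that a single one
    can be evaluated in every algebra. *)
Definition evl (p : seq (K * tree)) : A := \sum_(c <- p) c.1 *: ev c.2.

Lemma evl_cons c p : evl (c :: p) = c.1 *: ev c.2 + evl p.
Proof. by rewrite /evl big_cons. Qed.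

Definition lin (a : K) (p q : seq (K * tree)) :=
  [seq (a * c.1, c.2) | c <- p] ++ q.

Lemma evl_lin a p q : evl (lin a p q) = a *: evl p + evl q.
Proof.
rewrite /evl big_cat big_map scaler_sumr; congr (_ + _).
by apply: eq_bigr => c _; rewrite scalerA.
Qed.

Lemma evl1 T : evl [:: (1, T)] = ev T.
Proof. by rewrite /evl big_seq1 scale1r. Qed.

End Evaluation.

Arguments ev : simpl never.

Definition pol (K : fieldType) n (p : seq (K * tree)) :=
  all (fun c => is_leaf c.2 || (nodes c.2 == n)) p.

Lemma pol_lin (K : fieldType) n (a : K) p q :
  pol n p -> pol n q -> pol n (lin a p q).
Proof. by move=> hp hq; rewrite /pol all_cat all_map; apply/andP. Qed.

(** * Rewriting products of normal forms, uniformly in the algebra *)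

Section Combinations.
Variable K : fieldType.

(** The list [p] is chosen before the algebra and its element: freeness will rest on the rewriting
    being the same everywhere. *)
Definition combo (n : nat) (F : forall A : triop K, A -> A) :=
  exists2 p, pol n p & forall (A : triop K) (x : A), is_dend2 A ->
    F A x = evl x p.

Lemma combo_ext n (F G : forall A : triop K, A -> A) :
  (forall (A : triop K) (x : A), is_dend2 A -> F A x = G A x) ->
  combo n G -> combo n F.
Proof.
by move=> eFG [p hp e]; exists p => // A x dA; rewrite eFG ?e.
Qed.

Lemma combo0 n : combo n (fun A _ => 0).
Proof. by exists [::] => // A x _; rewrite /evl big_nil. Qed.

Lemma combo_ev n T : nodes T = n -> combo n (fun A x => ev x T).
Proof.
move=> sT; exists [:: (1, T)]; first by rewrite /pol /= sT eqxx orbT.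
by move=> A x _; rewrite evl1.
Qed.

Lemma combo_lin n a F G : combo n F -> combo n G ->
  combo n (fun A x => a *: F A x + G A x).
Proof.
move=> [p hp eF] [q hq eG]; exists (lin a p q); first exact: pol_lin.
by move=> A x dA; rewrite evl_lin eF ?eG.
Qed.

Lemma comboD n F G : combo n F -> combo n G ->
  combo n (fun A x => F A x + G A x).
Proof.
by move=> hF /(combo_lin 1 hF); apply: combo_ext => A x _; rewrite scale1r.
Qed.

(** [G] is a context linear in its hole; [g] is its effect on trees when filling the hole with a
    nonempty normal form gives a normal form again. *)
Lemma combo_map n m (g : tree -> tree) (G : forall A : triop K, A -> A -> A) F :
  (forall A x, is_dend2 A -> linear (G A x)) ->
  (forall T, nodes T = n -> ~~ is_leaf T -> nodes (g T) = m) ->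
  (forall A x, is_dend2 A -> forall T, ~~ is_leaf T ->
     G A x (ev x T) = ev x (g T)) ->
  combo n F -> combo m (fun A x => G A x (F A x)).
Proof.
move=> linG sg eG [p hp eF].
apply: combo_ext (fun A x dA => congr1 (G A x) (eF A x dA)) _.
elim: p hp {F eF} => [_|[a T] p IHp /= /andP[hT /IHp{}IHp]].
  apply: combo_ext (combo0 m) => A x dA; rewrite /evl big_nil.
  by have := linG A x dA (-1) 0 0; rewrite scaler0 addr0 scaleN1r addNr.
have [lT|lT] := boolP (is_leaf T).
  by apply: combo_ext IHp => A x dA; case: T lT {hT} => // _;
    rewrite evl_cons scaler0 add0r.
have /combo_ev/(combo_lin a)/(_ IHp) : nodes (g T) = m.
  by apply: sg => //; apply/eqP; rewrite (negPf lT) in hT.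
by apply: combo_ext => A x dA; rewrite evl_cons linG // eG.
Qed.

Lemma combo_star n F G :
  (forall k, combo n (fun A x => opk k (F A x) (G A x))) ->
  combo n (fun A x => F A x \star G A x).
Proof.
move=> h; do !apply: comboD; first exact: (h Prec).
  exact: (h Circ).
exact: (h Succ).
Qed.

(** Induction on the total number of nodes: the relations move the operations down to smaller trees,
    and [combo_map] puts the results back into their context. *)
Lemma combo_opk_ev k L R :
  combo (nodes L + nodes R) (fun A x => opk k (ev x L) (ev x R)).
Proof.
move: {2}(nodes L + nodes R)%N (leqnn (nodes L + nodes R)) => N.
elim: N k L R => [|N IHN] k L R.
  rewrite leqn0 addn_eq0 => /andP[_]; rewrite nodes_eq0.
  case: R => // _; apply: combo_ext (combo0 _) => A x dA; exact: opk0r.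
have [|nL] := boolP (is_leaf L).
  by case: L => // _ _; apply: combo_ext (combo0 _) => A x dA; exact: opk0l.
case: R => [|A' B' C'] hN.
  by apply: combo_ext (combo0 _) => A x dA; exact: opk0r.
rewrite /= in hN; case: k; rewrite /opk.
(* Here $L=A\circ(B\succ(x\prec C))$, and [prec_node] leaves only $C\star R$ to rewrite; if $C$ is
   empty, $R$ takes its place. *)
- case: L nL hN => // A B C _ /= hN.
  have [lC|lC] := boolP (is_leaf C).
    apply: combo_ext (@combo_ev _ (Node A B (Node A' B' C')) _) => [D x dD /=|].
      by rewrite prec_node // lC.
    by case: C lC hN => //= _; lia.
  pose G (D : triop K) x u : D := ocirc x A (osucc x B (x \prec u)).
  have st : combo (nodes C + (nodes A' + nodes B' + nodes C').+1)
      (fun D x => ev x C \star ev x (Node A' B' C')).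
    by apply: combo_star => k'; apply: (IHN k' C (Node A' B' C')) => /=; lia.
  apply: combo_ext (combo_map (g := Node A B) (G := G) _ _ _ st).
  + by move=> D x dD /=; rewrite prec_node // (negPf lC).
  + by move=> D x dD a u v; rewrite /G (precDr dD) osucc_lin ?ocirc_lin.
  + by move=> T /= sT _; lia.
  + by move=> D x dD T lT; rewrite ev_node /oprec (negPf lT).
(* Write $R=A'\circ z$. By [dend2_pc], $L\circ R=(L\prec A')\circ z-L\circ(A'\succ z)$; these terms
   are [h1] and [h2]. If $A'$ is empty, $L$ takes its place. *)
- have [lA'|lA'] := boolP (is_leaf A').
    apply: combo_ext (@combo_ev _ (Node L B' C') _) => [D x dD /=|].
      by rewrite !ev_node /ocirc lA' (negPf nL).
    by case: A' lA' hN => //= _; lia.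
  have cLA : combo (nodes L + nodes A') (fun D x => ev x L \prec ev x A').
    by apply: (IHN Prec); lia.
  pose G (D : triop K) x u : D := u \circ osucc x B' (oprec x C').
  have h1 : combo (nodes L + (nodes A' + nodes B' + nodes C').+1)
      (fun D x => G D x (ev x L \prec ev x A')).
    apply: (combo_map (g := fun T => Node T B' C') _ _ _ cLA).
    + by move=> D x dD a u v; rewrite /G (circDl dD).
    + by move=> T /= sT _; lia.
    + by move=> D x dD T lT; rewrite ev_node /ocirc (negPf lT).
  (* If $z=B'\succ y$, then [dend2_ss] gives $A'\succ z=(A'\star B')\succ y$, so only the middle
     subtree has to be rewritten. *)
  have h2 : combo (nodes L + (nodes A' + nodes B' + nodes C').+1)
      (fun D x => ev x L \circ (ev x A' \succ osucc x B' (oprec x C'))).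
    have [lB'|lB'] := boolP (is_leaf B').
      apply: combo_ext (@combo_ev _ (Node L A' C') _) => [D x dD /=|].
        by rewrite !ev_node /ocirc (negPf nL) /osucc lB' (negPf lA').
      by case: B' lB' {hN h1 G} => //= _; lia.
    have st : combo (nodes A' + nodes B') (fun D x => ev x A' \star ev x B').
      by apply: combo_star => k'; apply: IHN; lia.
    pose H (D : triop K) x u : D := ev x L \circ (u \succ oprec x C').
    apply: combo_ext (combo_map (g := fun T => Node L T C') (G := H) _ _ _ st).
    + by move=> D x dD /=; rewrite /H (dend2_ss dD) /osucc (negPf lB').
    + by move=> D x dD a u v; rewrite /H (succDl dD) (circDr dD).
    + by move=> T /= sT _; lia.
    + by move=> D x dD T lT; rewrite ev_node /ocirc /osucc (negPf nL) (negPf lT).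
  apply: combo_ext (combo_lin (-1) h2 h1) => D x dD /=.
  rewrite ev_node /G (dend2_pc dD) /ocirc (negPf lA') (circDr1 dD).
  by rewrite scaleN1r addrC addrK.
(* For $\succ$: if $R=A'\circ z$, then [dend2_cc] gives $L\succ R=(L\circ A'+L\succ A')\circ z$; if
   $A'$ is empty and $R=B'\succ y$, then [dend2_ss] gives $(L\star B')\succ y$. *)
have [lA'|lA'] := boolP (is_leaf A'); last first.
  have st : combo (nodes L + nodes A')
      (fun D x => ev x L \circ ev x A' + ev x L \succ ev x A').
    by apply: comboD; [apply: (IHN Circ) | apply: (IHN Succ)]; lia.
  pose G (D : triop K) x u : D := u \circ osucc x B' (oprec x C').
  apply: combo_ext (combo_map (g := fun T => Node T B' C') (G := G) _ _ _ st).
  + by move=> D x dD /=; rewrite /G (dend2_cc dD) ev_node /ocirc (negPf lA').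
  + by move=> D x dD a u v; rewrite /G (circDl dD).
  + by move=> T /= sT _; lia.
  + by move=> D x dD T lT; rewrite ev_node /ocirc (negPf lT).
case: A' lA' hN => //= _ hN.
have [lB'|lB'] := boolP (is_leaf B').
  apply: combo_ext (@combo_ev _ (Node Leaf L C') _) => [D x dD /=|].
    by rewrite !ev_node /ocirc /osucc lB' (negPf nL).
  by case: B' lB' {hN} => //= _; lia.
have st : combo (nodes L + nodes B') (fun D x => ev x L \star ev x B').
  by apply: combo_star => k'; apply: IHN; lia.
pose G (D : triop K) x u : D := u \succ oprec x C'.
apply: combo_ext (combo_map (g := fun T => Node Leaf T C') (G := G) _ _ _ st).
+ by move=> D x dD /=; rewrite /G (dend2_ss dD) ev_node /ocirc /osucc (negPf lB').
+ by move=> D x dD a u v; rewrite /G (succDl dD).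
+ by move=> T /= sT _; lia.
+ by move=> D x dD T lT; rewrite ev_node /ocirc /osucc (negPf lT).
Qed.

(** One [r] is found for all algebras and all degrees, so that it serves both the universal property
    and the degree components. *)
Lemma evl_opk k (p q : seq (K * tree)) : exists r,
  (forall m n, pol m p -> pol n q -> pol (m + n) r) /\
  forall (A : triop K) (x : A), is_dend2 A ->
    opk k (evl x p) (evl x q) = evl x r.
Proof.
elim: p => [|[a T] p [r1 [hr1 e1]]].
  exists [::]; split=> // A x dA.
  by rewrite /evl !big_nil opk0l.
suff [r2 [hr2 e2]] : exists r,
    (forall m n, is_leaf T || (nodes T == m) -> pol n q -> pol (m + n) r) /\
    forall (A : triop K) (x : A), is_dend2 A ->
      opk k (ev x T) (evl x q) = evl x r.
  exists (lin a r2 r1); split=> [m n /andP[hT hp] hq|A x dA].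
    by apply: pol_lin; [exact: hr2 | exact: hr1].
  by rewrite evl_cons evl_lin opkDl // e1 // e2.
elim: q {r1 hr1 e1} => [|[b U] q [r1 [hr1 e1]]].
  exists [::]; split=> // A x dA.
  by rewrite /evl !big_nil opk0r.
suff [r2 [hr2 e2]] : exists r,
    (forall m n, is_leaf T || (nodes T == m) -> is_leaf U || (nodes U == n) ->
       pol (m + n) r) /\
    forall (A : triop K) (x : A), is_dend2 A ->
      opk k (ev x T) (ev x U) = evl x r.
  exists (lin b r2 r1); split=> [m n hT /andP[hU hq]|A x dA].
    by apply: pol_lin; [exact: hr2 | exact: hr1].
  by rewrite evl_cons evl_lin opkDr // e1 // e2.
have [lT|lT] := boolP (is_leaf T).
  exists [::]; split=> // A x dA.
  by case: T lT {r1 hr1 e1} => // _; rewrite /evl big_nil opk0l.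
have [lU|lU] := boolP (is_leaf U).
  exists [::]; split=> // A x dA.
  by case: U lU => // _; rewrite /evl big_nil opk0r.
have [r hr e] := combo_opk_ev k T U; exists r; split=> [m n|//].
by rewrite /= => /eqP <- /eqP <-.
Qed.

End Combinations.

(** * Cuts of words *)

Local Close Scope ring_scope.

Lemma split_last (T : Type) (P : pred T) (s : seq T) : has P s ->
  exists s1 x s2, [/\ s = s1 ++ x :: s2, P x & all (predC P) s2].
Proof.
elim/last_ind: s => [|s y IHs] //; rewrite has_rcons.
have [Py _|nPy /= /IHs[s1 [x [s2 [-> Px Ps2]]]]] := boolP (P y).
  by exists s, y, [::]; rewrite cats1.
by exists s1, x, (rcons s2 y); rewrite rcons_cat all_rcons /= nPy.
Qed.

(** The last letter [p] is always a right-to-left minimum. The letters of [t2] exceed [p] and so are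
    none, and [r], at most [p], is the next one. *)
Lemma rl_minima_cat (t1 t2 : seq nat) (r p : nat) :
  r <= p -> all (ltn p) t2 ->
  let t := t1 ++ r :: rcons t2 p in m1 t = (size t).-1 /\ m2 t = size t1.
Proof.
move=> rp pt2 t.
have st : size t = size t1 + (1 + (size t2 + 1)).
  by rewrite size_cat /= size_rcons; lia.
have [X eX] : exists X, rl_minima t = X ++ [:: size t1; (size t).-1].
  rewrite /rl_minima [in iota _ _]st !iotaD !filter_cat; eexists; congr (_ ++ _).
  rewrite add0n /= nth_cat ltnn subnn /=.
  have -> : drop (size t1).+1 t = rcons t2 p.
    by rewrite drop_cat ltnNge leqnSn subSnn /= drop0.
  rewrite all_rcons rp (sub_all _ pt2) /= => [|i /= pi]; last first.
    exact: leq_trans (ltnW pi).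
  rewrite (@eq_in_filter _ _ pred0) => [|i]; last first.
    rewrite mem_iota => hi; apply/negbTE/allPn; exists p.
      have -> : t = (t1 ++ r :: t2) ++ [:: p] by rewrite /t -cats1 -catA.
      rewrite drop_cat size_cat /=; case: ifP => _.
        by rewrite mem_cat inE eqxx orbT.
      have -> : i.+1 - (size t1 + (size t2).+1) = 0 by lia.
      by rewrite inE.
    rewrite -ltnNge /t nth_cat ifN; last by lia.
    have -> : i - size t1 = (i - (size t1).+1).+1 by lia.
    rewrite /= nth_rcons ifT; last by lia.
    have hi' : i - (size t1).+1 < size t2 by lia.
    exact: (allP pt2 _ (mem_nth 0 hi')).
  rewrite filter_pred0 /= drop_oversize; last by rewrite st; lia.
  by rewrite st /=; do 2 f_equal; lia.
by rewrite /m1 /m2 eX rev_cat.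
Qed.

Definition trues (m : bitseq) : seq nat :=
  [seq k <- iota 0 (size m) | nth false m k].

Lemma trues_cat m1 m2 :
  trues (m1 ++ m2) = trues m1 ++ [seq size m1 + k | k <- trues m2].
Proof.
rewrite /trues size_cat iotaD filter_cat; congr (_ ++ _).
  apply: eq_in_filter => k; rewrite mem_iota => hk.
  by rewrite nth_cat ifT.
rewrite addnC iotaDl filter_map; congr map; apply: eq_filter => k /=.
by rewrite nth_cat ifN ?addKn // -leqNgt leq_addr.
Qed.

Lemma size_trues m : size (trues m) = count id m.
Proof.
elim/last_ind: m => // m b IHm.
by rewrite -cats1 trues_cat size_cat size_map IHm count_cat; case: b.
Qed.

Lemma nth_trues_lt m i : i < count id m -> nth 0 (trues m) i < size m.
Proof.
rewrite -size_trues => hi; have := mem_nth 0 hi.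
by rewrite mem_filter mem_iota => /andP[].
Qed.

Lemma trues_nil m : all negb m -> trues m = [::].
Proof.
by move=> h; apply: size0nil; rewrite size_trues; apply/eqP;
   rewrite -leqn0 leqNgt -has_count -all_predC.
Qed.

Lemma posrE m i : posr m i = nth 0 (trues (map negb m)) i.
Proof.
rewrite /posr /trues size_map; congr nth; apply: eq_in_filter => k.
by rewrite mem_iota => hk; rewrite (nth_map false).
Qed.

Definition low (a : nat) (w : seq nat) := [seq i <- w | i <= a].
Definition high (a : nat) (w : seq nat) := [seq i - a | i <- w & a < i].

(* The letter of [w] at position [m2 w]. *)
Definition next_min (w : seq nat) : nat :=
  last 0 (low (last 0 w) (take (size w).-1 w)).

Lemma next_min_rcons v p : next_min (rcons v p) = last 0 (low p v).
Proof. by rewrite /next_min last_rcons size_rcons /= -cats1 take_size_cat. Qed.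

Lemma last_low a w : last 0 (low a w) <= a.
Proof.
have := mem_last 0 (low a w); rewrite inE => /orP[/eqP -> //|].
by rewrite mem_filter => /andP[].
Qed.

Lemma next_min_le w : next_min w <= last 0 w.
Proof. exact: last_low. Qed.

(* Whether the cut of [w] between its letters at most [a] and its letters
   larger than [a] contributes to the operation [k]. *)
Definition cut_cond (k : kind) (w : seq nat) (a : nat) : bool :=
  match k with
  | Prec => last 0 w <= a
  | Circ => next_min w <= a < last 0 w
  | Succ => a < next_min w
  end.

Definition shuffle_cond (k : kind) (s t : perm2) : pred bitseq :=
  match k with
  | Prec => prec_cond s t | Circ => circ_cond s t | Succ => succ_cond s t end.

Lemma count_mask_low a w : count id (map (leq^~ a) w) = size (low a w).
Proof. by rewrite count_map size_filter. Qed.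

Lemma count_mask_high a w :
  count id (map negb (map (leq^~ a) w)) = size (high a w).
Proof.
rewrite -map_comp count_map size_map size_filter; apply: eq_count => i /=.
by rewrite -ltnNge.
Qed.

Lemma high_cat a u v : high a (u ++ v) = high a u ++ high a v.
Proof. by rewrite /high filter_cat map_cat. Qed.

Lemma low_cat a u v : low a (u ++ v) = low a u ++ low a v.
Proof. exact: filter_cat. Qed.

(** Comparisons of positions in the shuffle become comparisons of the values [last 0 w] and
    [next_min w] with the cut [a]. The two [has] hypotheses ensure that [w] and its high part have a
    second right-to-left minimum. *)
Lemma mask_cond a w :
  low a w != [::] -> high a w != [::] ->
  has (leq^~ (last 0 w)) (take (size w).-1 w) ->
  (let t := high a w in has (leq^~ (last 0 t)) (take (size t).-1 t)) ->
  let m := map (leq^~ a) w in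
  let lastl := posl m (size (low a w)).-1 in
  [/\ (posr m (m1 (high a w)) < lastl) = (last 0 w <= a),
      (lastl < posr m (m1 (high a w))) = (a < last 0 w),
      (posr m (m2 (high a w)) < lastl) = (next_min w <= a) &
      (lastl < posr m (m2 (high a w))) = (a < next_min w)].
Proof.
move=> loww highw dupw dupt m lastl.
have [t1 [t2 [r [p' [rp' pt2 et]]]]] : exists t1 t2 r p',
    [/\ r <= p', all (ltn p') t2 & high a w = t1 ++ r :: rcons t2 p'].
  move: dupt; case/lastP: (high a w) highw => // t p' _.
  rewrite /= last_rcons size_rcons -cats1 take_size_cat //.
  move=> /split_last[t1 [r [t2 [-> rp pt2]]]].
  exists t1, t2, r, p'; split => //; last by rewrite cats1 rcons_cat.
  by apply: sub_all pt2 => i /=; rewrite -ltnNge.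
have [em1 em2] := rl_minima_cat t1 rp' pt2; rewrite -et in em1 em2.
have lt_m1 : m1 (high a w) < size (high a w).
  by rewrite em1 et size_cat /=; lia.
have lt_m2 : m2 (high a w) < size (high a w).
  by rewrite em2 et size_cat /=; lia.
have hm : count id (map negb m) = size (high a w) by exact: count_mask_high.
have cm : count id m = size (low a w) by exact: count_mask_low.
have low0 : 0 < size (low a w) by rewrite lt0n size_eq0.
rewrite {}/lastl; move: dupw dupt hm cm lt_m1 lt_m2; rewrite {}/m.
case/lastP: w low0 {et em2 loww highw} em1 => // g p low0 em1.
rewrite last_rcons size_rcons next_min_rcons /= -[in take _ _]cats1 take_size_cat //.
move=> dupw dupt.
(* If [p <= a], the low part ends with the last letter of [w], to the right of the whole high part;
   otherwise [p] closes the high part. *)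
have [pa|ap] := leqP p a.
  rewrite map_rcons pa -!cats1 => hm cm lt_m1 lt_m2; set lastl := posl _ _.
  have -> : lastl = size g.
    rewrite /lastl -cm /posl -/(trues _) trues_cat count_cat /= addn1 /=.
    by rewrite nth_cat size_trues ltnn subnn /= addn0 size_map.
  have hpos i : i < size (high a (g ++ [:: p])) ->
      posr (map (leq^~ a) g ++ [:: true]) i < size g.
    move=> hi; rewrite posrE map_cat trues_cat /= cats0.
    have -> : size g = size (map negb (map (leq^~ a) g)) by rewrite !size_map.
    apply: nth_trues_lt; rewrite count_mask_high.
    by move: hi; rewrite high_cat size_cat /high /= [a < p]ltnNge pa /= addn0.
  have := hpos _ lt_m1; have := hpos _ lt_m2; have := last_low p g.
  by split; lia.
rewrite map_rcons [p <= a]leqNgt ap /= => hm cm lt_m1 lt_m2; set lastl := posl _ _.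
have lastl_lt : lastl < size g.
  rewrite /lastl -cm /posl -/(trues _) -cats1 trues_cat /= cats0 count_cat /=.
  have -> : size g = size (map (leq^~ a) g) by rewrite size_map.
  apply: nth_trues_lt; rewrite addn0.
  by move: low0; rewrite -cm -cats1 count_cat /= addn0; lia.
have -> : posr (rcons (map (leq^~ a) g) false) (m1 (high a (rcons g p))) = size g.
  rewrite em1 -hm posrE -cats1 map_cat trues_cat count_cat /= addn1 /=.
  by rewrite nth_cat size_trues ltnn subnn /= addn0 !size_map.
(* [q] is the last letter at most [p] before the final [p]; the letters of [g2] exceed [p], hence
   [a], so they are all high. *)
have [g1 [q [g2 [eg qp pg2]]]] := split_last dupw.
have -> : last 0 (low p g) = q.
  rewrite eg low_cat last_cat /low /= qp.
  rewrite (@eq_in_filter _ _ pred0 g2) ?filter_pred0 // => i /(allP pg2) /=.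
  exact: negbTE.
have ag2 : all negb (map (leq^~ a) g2).
  rewrite all_map; apply: sub_all pg2 => i /=; rewrite -!ltnNge.
  exact: ltn_trans.
set P2 := posr _ _; rewrite [lastl < _]lastl_lt ltnNge ltnW //=.
suff [h1 h2] : (P2 < lastl) = (q <= a) /\ (lastl < P2) = (a < q) by [].
have nohigh : high a (rcons g p) = high a g1 ++ high a (q :: g2) ++ [:: p - a].
  by rewrite -cats1 high_cat eg high_cat -catA /high /= ap.
have pg2' : all (ltn (p - a)) (high a g2).
  rewrite all_map all_filter; apply: sub_all pg2 => i /=.
  by rewrite -ltnNge => pi; apply/implyP => ai; lia.
(* If [a < q], then [q] is the letter at [m2] of the high part and no low letter follows it.
   Otherwise [q] is the last low letter, and the letter at [m2] precedes it. *)
have [aq|qa] := ltnP a q.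
  suff : lastl < P2 by lia.
  have -> : P2 = size g1.
    have [] := @rl_minima_cat (high a g1) (high a g2) (q - a) (p - a).
    - by lia.
    - exact: pg2'.
    have -> : high a g1 ++ q - a :: rcons (high a g2) (p - a) =
      high a (rcons g p) by rewrite nohigh /high /= aq -cats1.
    move=> _ e2; rewrite /P2 e2 posrE eg map_cat rcons_cat map_cat /=.
    rewrite [q <= a]leqNgt aq.
    rewrite trues_cat nth_cat size_trues count_mask_high ltnn subnn.
    by rewrite /trues /= addn0 !size_map.
  have trE : trues (rcons (map (leq^~ a) g) false) = trues (map (leq^~ a) g1).
    rewrite eg map_cat /= [q <= a]leqNgt aq rcons_cat trues_cat.
    rewrite [trues (_ :: _)]trues_nil ?cats0 //.
    by rewrite /= all_rcons.
  rewrite /lastl /posl -/(trues _) trE -(size_map (leq^~ a) g1).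
  apply: nth_trues_lt; rewrite -size_trues -trE size_trues cm.
  by move: low0; rewrite -cm; lia.
suff : P2 < lastl by lia.
have -> : lastl = size g1.
  rewrite /lastl -cm /posl -/(trues _) eg map_cat /= qa rcons_cat.
  rewrite trues_cat count_cat.
  have -> : trues (true :: rcons (map (leq^~ a) g2) false) = [:: 0].
    rewrite -cat1s trues_cat [trues (rcons _ _)]trues_nil //.
    by rewrite all_rcons.
  have -> : count id (true :: rcons (map (leq^~ a) g2) false) = 1.
    congr (_.+1).
    by apply/eqP; rewrite -leqn0 leqNgt -has_count -all_predC all_rcons.
  by rewrite addn1 /= nth_cat size_trues ltnn subnn /= addn0 size_map.
(* The high part has a letter at most [p - a] before its last one; the letters coming from [g2] are
   larger, so it comes from [g1], before [q]. *)
have : has (leq^~ (p - a)) (high a g1).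
  move: dupt; rewrite nohigh catA last_cat /= size_cat addn1 take_size_cat //.
  have -> : high a (q :: g2) = high a g2 by rewrite /high /= ltnNge qa.
  rewrite has_cat => /orP[//|/hasP[i /(allP pg2')]]; rewrite /= ltnNge.
  by move/negP.
move=> /split_last[s1 [r' [s2 [es rp2 ps2]]]].
have [] := @rl_minima_cat s1 (s2 ++ high a g2) r' (p - a).
- by [].
- by rewrite all_cat pg2' andbT; apply: sub_all ps2 => i /=; rewrite -ltnNge.
have -> : s1 ++ r' :: rcons (s2 ++ high a g2) (p - a) = high a (rcons g p).
  by rewrite nohigh es /high /= ltnNge qa /= -cats1 -!catA.
move=> _ e2; rewrite /P2 e2 posrE eg map_cat rcons_cat map_cat trues_cat nth_cat.
rewrite size_trues count_mask_high es size_cat /= ifT; last by lia.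
have -> : size g1 = size (map negb (map (leq^~ a) g1)) by rewrite !size_map.
by apply: nth_trues_lt; rewrite count_mask_high es size_cat /=; lia.
Qed.

(** Unlike [is_perm2], this admits the empty word, which arises when one side of a cut is empty. *)
Definition balanced (n : nat) (w : seq nat) : bool :=
  perm_eq w (iota 1 n ++ iota 1 n).

Lemma is_perm2E w : is_perm2 w = (0 < (size w)./2) && balanced (size w)./2 w.
Proof. by []. Qed.

Lemma size_balanced n w : balanced n w -> size w = n.*2.
Proof. by move=> /perm_size; rewrite size_cat size_iota addnn. Qed.

Lemma balanced_perm2 n w : balanced n w -> 0 < n -> is_perm2 w.
Proof. by move=> bw n0; rewrite is_perm2E (size_balanced bw) doubleK n0. Qed.

Lemma filter_iota_le a m n :
  [seq i <- iota m n | i <= a] = iota m (minn n (a.+1 - m)).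
Proof.
elim: n m => [|n IHn] m //=; first by rewrite min0n.
rewrite IHn; case: leqP => h.
  by have -> : minn n.+1 (a.+1 - m) = (minn n (a.+1 - m.+1)).+1 by lia.
have [-> ->] : minn n.+1 (a.+1 - m) = 0 /\ minn n (a.+1 - m.+1) = 0 by lia.
by [].
Qed.

Lemma filter_iota_gt a n :
  [seq i - a | i <- iota 1 n & a < i] = iota 1 (n - a).
Proof.
have [na|an] := leqP n a.
  rewrite (@eq_in_filter _ _ pred0) ?filter_pred0; last first.
    by move=> i; rewrite mem_iota /= => hi; lia.
  by have -> : n - a = 0 by lia.
have {1}-> : n = a + (n - a) by lia.
rewrite iotaD filter_cat map_cat.
rewrite (@eq_in_filter _ _ pred0) ?filter_pred0; last first.
  by move=> i; rewrite mem_iota /= => hi; lia.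
rewrite (@eq_in_filter _ _ xpredT) ?filter_predT; last first.
  by move=> i; rewrite mem_iota /= => hi; lia.
rewrite cat0s addnC iotaDl -map_comp; apply: map_id_in => i _ /=.
by rewrite addKn.
Qed.

Lemma balanced_low n a w : balanced n w -> balanced (minn n a) (low a w).
Proof.
move=> /(perm_filter (leq^~ a)); rewrite filter_cat !filter_iota_le.
by rewrite subn1.
Qed.

Lemma balanced_high n a w : balanced n w -> balanced (n - a) (high a w).
Proof.
move=> /(perm_filter (ltn a))/(perm_map (subn^~ a)).
by rewrite filter_cat map_cat !filter_iota_gt.
Qed.

Lemma low_low a b w : a <= b -> low a (low b w) = low a w.
Proof.
move=> ab; rewrite /low -filter_predI; apply: eq_filter => i /=.
by case: leqP => //= ia; apply: leq_trans ab.
Qed.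

Lemma low_high a b w : a <= b -> low (b - a) (high a w) = high a (low b w).
Proof.
move=> ab; rewrite /low /high filter_map -!filter_predI; congr map.
by apply: eq_filter => i /=; lia.
Qed.

Lemma high_high a b w : a <= b -> high (b - a) (high a w) = high b w.
Proof.
move=> ab; rewrite /high filter_map -map_comp -filter_predI.
rewrite (@eq_filter _ _ (ltn b)) => [|i /=]; last by lia.
by apply: eq_map => i /=; lia.
Qed.

Lemma low0 n w : balanced n w -> low 0 w = [::].
Proof. by move=> /(balanced_low 0)/size_balanced; rewrite minn0 => /size0nil. Qed.

Lemma interleave_mask a m s t :
  all (leq^~ a) s -> all (ltn a) t -> count id m = size s ->
  size m = size s + size t ->
  [/\ map (leq^~ a) (interleave m s t) = m, low a (interleave m s t) = s &
      [seq i <- interleave m s t | a < i] = t].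
Proof.
elim: m s t => [|b m IHm] s t.
  by case: s => [|? ?] //=; case: t.
case: b; [case: s => [|i s] //= | case: t => [|i t] //=].
- move=> /andP[ia hs] ht hc hm.
  have [||e1 e2 e3] := IHm s t hs ht; [by lia|by lia|].
  by rewrite /low /= ia e1 ltnNge ia /= e3; split=> //; congr (_ :: _).
- move=> _ _; rewrite add0n addn0 => hc hm.
  by have := count_size id m; rewrite hc -hm ltnn.
move=> hs /andP[ia ht]; rewrite add0n addnS => hc [hm].
have [//||e1 e2 e3] := IHm s t hs ht; [by []|].
by rewrite /low /= leqNgt ia e1 /= e3; split=> //; congr (_ :: _).
Qed.

Lemma interleave_cut a w :
  interleave (map (leq^~ a) w) (low a w) [seq i <- w | a < i] = w.
Proof.
by elim: w => //= i w IHw; rewrite /low /= ltnNge; case: leqP => _ /=;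
   rewrite IHw.
Qed.

Lemma shift_high a (s t w : seq nat) :
  max_letter s = a -> t = high a w -> shift s t = [seq i <- w | a < i].
Proof.
move=> ms ->; rewrite /shift ms -map_comp map_id_in // => i.
by rewrite mem_filter => /andP[ai _] /=; lia.
Qed.

Lemma high_shift a (s t w : seq nat) :
  max_letter s = a -> shift s t = [seq i <- w | a < i] -> t = high a w.
Proof.
move=> ms; rewrite /high => <-; rewrite /shift ms -map_comp map_id_in // => i _.
by rewrite /= addnK.
Qed.

(** The other copy of the last letter is a witness. *)
Lemma balanced_dup n w : balanced n w -> 0 < n ->
  has (leq^~ (last 0 w)) (take (size w).-1 w).
Proof.
move=> bw n0; case/lastP: w bw => [/size_balanced /=|v p bw]; first by lia.
rewrite last_rcons size_rcons -cats1 take_size_cat //.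
apply/hasP; exists p => //; rewrite -has_pred1 has_count.
have : count_mem p (rcons v p) = count_mem p (iota 1 n ++ iota 1 n).
  exact: (permP bw).
rewrite -cats1 !count_cat /= eqxx addn0.
by case: (count_mem p v) => //; lia.
Qed.

Lemma perm2_balanced (s : perm2) : 0 < (size s)./2 /\ balanced (size s)./2 s.
Proof. exact/andP/(valP s). Qed.

Lemma mask_cond_cut k (s t w : perm2) a :
  low a w = s -> high a w = t ->
  shuffle_cond k s t (map (leq^~ a) w) = cut_cond k w a.
Proof.
move=> ls ht; have [s0 _] := perm2_balanced s.
have [t0 bt] := perm2_balanced t; have [w0 bw] := perm2_balanced w.
have [] := @mask_cond a w.
- by rewrite ls; apply: contraTneq s0 => ->.
- by rewrite ht; apply: contraTneq t0 => ->.
- exact: balanced_dup bw w0.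
- by rewrite ht; apply: balanced_dup bt t0.
rewrite ls ht => h1 h2 h3 h4.
by case: k; rewrite /= /prec_cond /circ_cond /succ_cond ?h1 ?h2 ?h3 ?h4.
Qed.

(** The low part has $\min(n,a)$ distinct letters, and $a<n$ because [t] is nonempty; so [s]
    determines the cut. *)
Lemma cut_perm2 (s t w : perm2) a : s = low a w :> seq nat ->
  t = high a w :> seq nat -> a = (size s)./2 /\ a < (size w)./2.
Proof.
move=> es et; have [w0 bw] := perm2_balanced w; have [t0 _] := perm2_balanced t.
have /size_balanced : balanced (minn (size w)./2 a) s.
  by rewrite es; apply: balanced_low.
have /size_balanced : balanced ((size w)./2 - a) t.
  by rewrite et; apply: balanced_high.
move: t0; move: (size t) (size s) => x y; lia.
Qed.

(** * The operations of 2FQSym on coefficients *)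

Local Open Scope ring_scope.

Section Coefficients.
Variable K : fieldType.
Local Notation FQ := (fqsym2 K).

(** Indexing by all words, with value 0 outside 2-permutations, allows the parts of any cut as
    arguments. *)
Definition coef (u : FQ) (w : seq nat) : K :=
  if insub w is Some s then (u : {malg K[perm2]})@_s else 0.

Lemma coef_perm2 u (s : perm2) : coef u s = (u : {malg K[perm2]})@_s.
Proof. by rewrite /coef valK. Qed.

Lemma coef_lin a u v w : coef (a *: u + v) w = a * coef u w + coef v w.
Proof.
rewrite /coef; case: insub => [s|]; first by rewrite mcoeffD mcoeffZ.
by rewrite mulr0 addr0.
Qed.

Lemma coef_nil u : coef u [::] = 0.
Proof. by rewrite /coef insubF. Qed.

Lemma coef_inj u v : (forall n w, balanced n w -> coef u w = coef v w) -> u = v.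
Proof.
move=> euv; apply/malgP => s; rewrite -!coef_perm2.
exact: euv (perm2_balanced s).2.
Qed.

Lemma coef_msupp u w : coef u w =
  \sum_(s <- msupp (u : {malg K[perm2]}))
    (u : {malg K[perm2]})@_s *+ (w == s :> seq nat).
Proof.
rewrite /coef; case: insubP => [s _ <-|wN]; last first.
  rewrite big1 // => s _; case: eqP => // e.
  by move: wN; rewrite e (valP s).
case: msuppP => [hs|hs].
  rewrite (big_rem s hs) /= eqxx big_seq big1 ?addr0 // => t.
  rewrite mem_rem_uniq ?fset_uniq // inE => /andP[ts _].
  by rewrite (inj_eq val_inj) eq_sym (negPf ts).
rewrite big_seq big1 // => t ht; case: eqP => // /val_inj e.
by move: hs; rewrite e ht.
Qed.

(** At most one mask produces [g], and one does exactly when some cut of [g] gives [s] and [t]. Only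
    the cut at half the size of [s] can; summing over all [a] keeps the range independent of [s], so
    that sums can be exchanged. *)
Lemma coef_shuffle_sum k (s t g : perm2) N : ((size g)./2 <= N)%N ->
  (shuffle_sum K (shuffle_cond k) s t)@_g =
  \sum_(0 <= a < N)
    ((low a g == s) && (high a g == t) && cut_cond k g a)%:R.
Proof.
move=> gN; rewrite /shuffle_sum raddf_sum /=.
under eq_bigr do rewrite mcoeffU -val_eqE /=.
have max_s : max_letter s = (size s)./2 by exact/max_letter_perm2/(valP s).
have sz_mask (m : shuffle_mask (size s) (size t)) :
    count id (val m) = size s /\ size (val m) = (size s + size (shift s t))%N.
  by split; [exact/eqP/(valP m) | rewrite size_tuple size_map].
have lows : all (leq^~ (size s)./2) s.
  rewrite (perm_all _ (perm2_balanced s).2) all_cat andbb.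
  by apply/allP => i; rewrite mem_iota; lia.
have hight : all (ltn (size s)./2) (shift s t).
  rewrite /shift max_s all_map; apply/allP => i.
  rewrite (perm_mem (perm2_balanced t).2) mem_cat orbb mem_iota /=; lia.
have mask_of (m : shuffle_mask (size s) (size t)) :
    interleave (val m) s (shift s t) = g ->
    [/\ map (leq^~ (size s)./2) g = val m, low (size s)./2 g = s &
        high (size s)./2 g = t].
  move=> eg; have [cm szm] := sz_mask m.
  have [e1 e2 e3] := interleave_mask lows hight cm szm.
  by rewrite eg in e1 e2 e3; split => //; rewrite (high_shift max_s (esym e3)).
have [/andP[/eqP ls /eqP ht]|nst] :=
  boolP ((low (size s)./2 g == s) && (high (size s)./2 g == t)); last first.
  rewrite big1 => [|m _]; last first.
    case: eqP => // /mask_of[_ e1 e2].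
    by move: nst; rewrite e1 e2 !eqxx.
  rewrite big1 // => a _; case: eqP => //= e1; case: eqP => //= e2.
  have [ea _] := cut_perm2 (esym e1) (esym e2).
  by move: nst; rewrite -ea e1 e2 !eqxx.
have [_ alt] := cut_perm2 (esym ls) (esym ht).
rewrite [RHS](bigD1_seq (size s)./2) ?iota_uniq ?mem_index_iota
  ?(leq_trans alt gN) //=.
rewrite [X in _ = _ + X]big1 ?addr0 => [|a /eqP aN]; last first.
  case: eqP => //= e1; case: eqP => //= e2.
  by have [/aN] := cut_perm2 (esym e1) (esym e2).
rewrite ls ht !eqxx /= -(mask_cond_cut k ls ht).
pose m0 := map (leq^~ (size s)./2) g.
have sm0 : size m0 == (size s + size t)%N.
  rewrite size_map; have := perm2_balanced g; move: alt.
  have := size_balanced (balanced_high (size s)./2 (perm2_balanced g).2).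
  have := size_perm2 (valP s); have := size_perm2 (valP g).
  rewrite ht /=; move: (size s) (size t) (size g) => x y z; lia.
have cm0 : count id (Tuple sm0) == size s.
  by rewrite /= count_mask_low ls.
pose M0 : shuffle_mask (size s) (size t) := exist _ (Tuple sm0) cm0.
have mE (m : shuffle_mask (size s) (size t)) :
    (interleave (val m) s (shift s t) == g) = (m == M0).
  apply/eqP/eqP => [/mask_of[em _ _]|->].
    by apply/val_inj/val_inj; rewrite /= -em.
  have := interleave_cut (size s)./2 g.
  by rewrite ls -(shift_high max_s (esym ht)).
rewrite (eq_bigr (fun m => (m == M0)%:R)) => [|m _]; last by rewrite -mE.
rewrite big_mkcond (bigD1 M0) //= eqxx big1 ?addr0 => [|m /negPf mM].
  by case: (shuffle_cond _ _ _ _).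
by rewrite mM; case: ifP.
Qed.

(** The dual form of a product, [c] selecting the cuts that contribute. The free bound [N] lets the
    ranges of nested sums be matched. *)
Definition has_cut (F u v : FQ) (c : seq nat -> nat -> bool) :=
  forall n w N, balanced n w -> (n <= N)%N ->
  coef F w =
  \sum_(0 <= a < N) coef u (low a w) * coef v (high a w) * (c w a)%:R.

Lemma has_cut_opk k u v : has_cut (opk k u v) u v (cut_cond k).
Proof.
move=> n w N bw nN; case: n bw nN => [|n] bw nN.
  have /size0nil -> := size_balanced bw.
  by rewrite coef_nil big1 // => a _; rewrite coef_nil mul0r mul0r.
pose g := Perm2 (balanced_perm2 bw isT).
rewrite -[w]/(g : seq nat) coef_perm2.
have -> : (opk k u v : {malg K[perm2]}) = 
  bilinear_ext (shuffle_sum K (shuffle_cond k)) u v by case: k.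
rewrite /bilinear_ext raddf_sum /=.
have gN : ((size g)./2 <= N)%N by rewrite /= (size_balanced bw) doubleK.
under eq_bigr => s _.
  rewrite raddf_sum /=; under eq_bigr => t _.
    rewrite mcoeffZ (coef_shuffle_sum _ _ _ gN) mulr_sumr; over.
  rewrite exchange_big; over.
rewrite exchange_big; apply: eq_bigr => a _ /=.
rewrite !coef_msupp mulr_suml mulr_suml; apply: eq_bigr => s _.
rewrite mulr_sumr mulr_suml; apply: eq_bigr => t _.
by case: (_ == _); case: (_ == _); rewrite /= ?mulr1n ?mulr0n ?mulr0 ?mul0r.
Qed.

Lemma has_cutD F G u v c d : has_cut F u v c -> has_cut G u v d ->
  (forall w a, ~~ (c w a && d w a)) ->
  has_cut (F + G) u v (fun w a => c w a || d w a).
Proof.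
move=> hF hG cd n w N bw nN.
rewrite -[F]scale1r coef_lin mul1r (hF n w N) // (hG n w N) // -big_split.
apply: eq_bigr => a _ /=; rewrite -mulrDr; congr (_ * _).
by have := cd w a; case: (c w a); case: (d w a); rewrite ?addr0 ?add0r.
Qed.

Lemma has_cut_eq F u v c d : (forall w a, c w a = d w a) ->
  has_cut F u v c -> has_cut F u v d.
Proof.
move=> cd h n w N bw nN; rewrite (h n w N) //.
by under eq_bigr do rewrite cd.
Qed.

(** Both sides are sums over pairs of cuts $a<b$ of [g] into three parts: on the left [b] is cut
    first, then [a] in the low part; on the right [a] first, then $b-a$ in the high part. *)
Lemma has_cut_assoc (F G uv vw u v w : FQ) c1 c2 c3 c4 :
  has_cut uv u v c2 -> has_cut F uv w c1 ->
  has_cut vw v w c4 -> has_cut G u vw c3 ->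
  (forall g a b, (a < b)%N ->
     c2 (low b g) a && c1 g b = c3 g a && c4 (high a g) (b - a)%N) ->
  F = G.
Proof.
move=> huv hF hvw hG ce; apply: coef_inj => n g bg.
rewrite (hF n g n) // (hG n g n) //.
pose f a b := coef u (low a g) * coef v (high a (low b g)) * coef w (high b g) *
  (c3 g a && c4 (high a g) (b - a)%N)%:R.
transitivity (\sum_(0 <= b < n) \sum_(0 <= a < n) if (a < b)%N then f a b else 0).
  apply: eq_big_nat => b /andP[_ bn].
  rewrite (huv _ _ b (balanced_low b bg)) ?geq_minr // !mulr_suml.
  rewrite (@big_nat_widen _ _ _ 0 b n) ?(ltnW bn) //=.
  rewrite -[RHS]big_mkcond.
  rewrite big_nat_cond [RHS]big_nat_cond; apply: eq_bigr => a.
  move=> /andP[_ ab]; rewrite low_low ?(ltnW ab) // /f -ce //.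
  by rewrite -mulnb natrM; ring.
rewrite exchange_big /=; apply: eq_big_nat => a /andP[_ an].
rewrite (hvw _ _ (n - a)%N (balanced_high a bg)) // mulr_sumr mulr_suml.
transitivity (\sum_(a <= b < n) f a b).
  (* The added term $b=a$ is 0, because its middle part is the empty word. *)
  rewrite [LHS](@big_cat_nat _ _ _ a) ?(ltnW an) //= [X in X + _]big1_seq => [|b].
    rewrite add0r; apply: eq_big_nat => b /andP[ab _]; case: ltngtP ab => // <- _.
    rewrite /f; have := balanced_high a (balanced_low a bg).
    have -> : (minn n a - a = 0)%N by lia.
    by move=> /size_balanced/size0nil ->; rewrite coef_nil mulr0 !mul0r.
  by rewrite mem_index_iota /= => ba; case: ltnP => // ab; lia.
rewrite -{1}[a]add0n big_addn; apply: eq_bigr => b _.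
rewrite /f -(@low_high a) ?leq_addl // -(@high_high a (b + a)) ?leq_addl //.
by rewrite addnK -mulnb natrM; ring.
Qed.

(** * The last letter and [next_min] under cuts *)

Lemma last_low_le w b : (last 0 w <= b)%N ->
  last 0%N (low b w) = last 0%N w /\ next_min (low b w) = next_min w.
Proof.
case/lastP: w => [|v p] //; rewrite last_rcons => pb.
by rewrite -cats1 low_cat /low /= pb !cats1 last_rcons !next_min_rcons low_low.
Qed.

(** The letters between that of [next_min] and the last one exceed the last one, hence [b], and are
    cut off with it. *)
Lemma last_low_next w b : (next_min w <= b < last 0 w)%N ->
  last 0%N (low b w) = next_min w.
Proof.
case/lastP: w => [|v p] //; rewrite last_rcons next_min_rcons => /andP[qb bp].
rewrite -cats1 low_cat {2}/low /= leqNgt bp cats0 -(@low_low b p) ?(ltnW bp) //.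
case/lastP: (low p v) qb => // u q; rewrite last_rcons => qb.
by rewrite -cats1 low_cat /low /= qb cats1 last_rcons.
Qed.

Lemma last_high w a : (a < last 0 w)%N -> last 0%N (high a w) = (last 0 w - a)%N.
Proof.
case/lastP: w => [|v p] //; rewrite last_rcons => ap.
by rewrite -cats1 high_cat /high /= ap cats1 last_rcons.
Qed.

Lemma next_min_high w a : (a < next_min w)%N ->
  next_min (high a w) = (next_min w - a)%N.
Proof.
move=> aq; have ap := leq_trans aq (next_min_le w).
case/lastP: w aq ap => [|v p] //; rewrite last_rcons next_min_rcons => aq ap.
rewrite -cats1 high_cat {2}/high /= ap cats1 next_min_rcons low_high ?(ltnW ap) //.
exact: last_high.
Qed.

(** Since [next_min w <= last 0 w], the three conditions are disjoint and cover all cuts. *)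
Lemma star_cut u v : has_cut (u \star v) u v (fun _ _ => true).
Proof.
have := has_cutD (has_cutD (has_cut_opk Prec u v) (has_cut_opk Circ u v) _)
  (has_cut_opk Succ u v) _.
move=> h; apply: has_cut_eq (h _ _) => w a /=; have := next_min_le w; lia.
Qed.

Lemma circ_succ_cut u v :
  has_cut (u \circ v + u \succ v) u v (fun w a => (a < last 0 w)%N).
Proof.
have := has_cutD (has_cut_opk Circ u v) (has_cut_opk Succ u v) _.
move=> h; apply: has_cut_eq (h _) => w a /=; have := next_min_le w; lia.
Qed.

Lemma opk_fqsym2_bilinear k : bilinear_for *:%R *:%R (@opk K FQ k).
Proof.
split=> [v a u u'|u a v v']; apply: coef_inj => n w bw; rewrite coef_lin;
  rewrite !(has_cut_opk _ _ _ bw (leqnn n)) mulr_sumr -big_split;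
  by apply: eq_bigr => b _; rewrite /= coef_lin; ring.
Qed.

Lemma fqsym2_dend2 : is_dend2 FQ.
Proof.
split; [exact: (opk_fqsym2_bilinear Prec) | exact: (opk_fqsym2_bilinear Circ)
       | exact: (opk_fqsym2_bilinear Succ) | ..] => u v w.
- apply: (has_cut_assoc (has_cut_opk Prec u v) (has_cut_opk Prec _ w)
    (star_cut v w) (has_cut_opk Prec u _)) => g a b ab /=.
  by case: (leqP (last 0%N g) b) => [/last_low_le[-> _]|]; lia.
- apply: (has_cut_assoc (has_cut_opk Circ u v) (has_cut_opk Prec _ w)
    (has_cut_opk Prec v w) (has_cut_opk Circ u _)) => g a b ab /=.
  case: (leqP (last 0%N g) b) => [pb|bp]; last by rewrite last_high; lia.
  have [-> ->] := last_low_le pb.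
  by case: (ltnP a (last 0%N g)) => ap; [rewrite last_high //|]; lia.
- apply: (has_cut_assoc (has_cut_opk Succ u v) (has_cut_opk Prec _ w)
    (has_cut_opk Prec v w) (has_cut_opk Succ u _)) => g a b ab /=.
  have pq := next_min_le g.
  case: (leqP (last 0%N g) b) => [pb|bp]; last by rewrite last_high; lia.
  have [_ ->] := last_low_le pb; case: (ltnP a (next_min g)) => //= aq.
  by rewrite last_high; lia.
- apply: (has_cut_assoc (has_cut_opk Prec u v) (has_cut_opk Circ _ w)
    (circ_succ_cut v w) (has_cut_opk Circ u _)) => g a b ab /=.
  case: (boolP (next_min g <= b < last 0%N g)%N) => [h|h].
    by rewrite last_low_next // last_high; lia.
  case: (leqP (last 0%N g) a) => h'; first by lia.
  by rewrite last_high; lia.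
- apply: (has_cut_assoc (circ_succ_cut u v) (has_cut_opk Circ _ w)
    (has_cut_opk Circ v w) (has_cut_opk Succ u _)) => g a b ab /=.
  have pq := next_min_le g.
  case: (ltnP a (next_min g)) => [aq|qa] /=.
    rewrite next_min_high // last_high; last by lia.
    case: (boolP (next_min g <= b < last 0%N g)%N) => [h|h]; last by lia.
    by rewrite last_low_next //; lia.
  case: (boolP (next_min g <= b < last 0%N g)%N) => [h|h]; last by lia.
  by rewrite last_low_next //; lia.
apply: (has_cut_assoc (star_cut u v) (has_cut_opk Succ _ w)
  (has_cut_opk Succ v w) (has_cut_opk Succ u _)) => g a b ab /=.
case: (ltnP a (next_min g)) => [aq|qa] /=; last by lia.
by rewrite next_min_high //; lia.
Qed.

End Coefficients.
(** * Independence of the normal forms *)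

Local Close Scope ring_scope.

(** Among trees of equal size, the size of the left subtree dominates: the factorial weight exceeds
    any sum of the ranks of the three subtrees, as [rank_children] shows. *)
Fixpoint rank (T : tree) : nat :=
  if T is Node A B C then
    nodes A * (nodes A + nodes B + nodes C)`! + (rank A + rank B + rank C)
  else 0.

(** The extra 1 is attained when [a] or [b] is 0, and is absorbed by the strict inequalities of
    [rank_children]. *)
Lemma fact_superadditive a b : a`! + b`! <= (a + b)`!.+1.
Proof.
elim: b => [|b IHb]; first by rewrite addn0 addn1.
case: a IHb => [|a] IHb; first by rewrite add0n fact0 add1n.
have h1 : b`! <= (a.+1 + b)`! by apply: leq_fact; lia.
have h2 : a.+1`! <= (a.+1 + b)`! by apply: leq_fact; lia.
rewrite addnS [b.+1`!]factS [(a.+1 + b).+1`!]factS.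
apply: (leq_trans (leq_add h2 (leq_mul (leqnn _) h1))).
by rewrite -mulSn ltnW // ltnS leq_mul2r; lia.
Qed.

Lemma rank_children A B C :
  rank A < (nodes A)`! -> rank B < (nodes B)`! -> rank C < (nodes C)`! ->
  rank A + rank B + rank C < (nodes A + nodes B + nodes C)`!.
Proof.
move=> hA hB hC; have := fact_superadditive (nodes A) (nodes B).
have := fact_superadditive (nodes A + nodes B) (nodes C); lia.
Qed.

Lemma rank_lt T : rank T < (nodes T)`!.
Proof.
elim: T => [|A hA B hB C hC] //; rewrite factS.
rewrite mulSn /= [X in X < _]addnC -addSn leq_add ?rank_children //.
by rewrite leq_mul2r -addnA leq_addr orbT.
Qed.

Lemma rank_node_lt A B C A' B' C' :
  nodes A + nodes B + nodes C = nodes A' + nodes B' + nodes C' ->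
  nodes A < nodes A' -> rank (Node A B C) < rank (Node A' B' C').
Proof.
move=> e h; have := rank_children (rank_lt A) (rank_lt B) (rank_lt C).
move=> hr; rewrite /= -e.
apply: (@leq_trans (nodes A' * (nodes A + nodes B + nodes C)`!)).
  rewrite -addnS (leq_trans (leq_add (leqnn _) hr)) //.
  by rewrite -mulSnr leq_mul2r h orbT.
exact: leq_addr.
Qed.

(* The coefficient of this word is 1 in the element of the tree, and it
   vanishes for every other tree of the same or smaller rank. *)
Fixpoint tword (T : tree) : seq nat :=
  if T is Node A B C then
    let m := (nodes A + nodes B).+1 in
    rcons (map (addn (nodes A)) (tword B) ++
           m :: tword A ++ map (addn m) (tword C)) m
  else [::].

Lemma balanced_tword T : balanced (nodes T) (tword T).
Proof.
have shift_iota (p : pred nat) a n :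
    count (preim (addn a) p) (iota 1 n) = count p (iota (a + 1) n).
  by rewrite iotaDl count_map.
elim: T => [|A hA B hB C hC] //=; apply/permP => p.
have := permP hA p; have := permP hB (preim (addn (nodes A)) p).
have := permP hC (preim (addn (nodes A + nodes B).+1) p).
have -> : (nodes A + nodes B + nodes C).+1 =
  nodes A + (nodes B + (1 + nodes C)) by lia.
rewrite !iotaD -cats1 !count_cat /= !count_cat !count_map !shift_iota /=.
have -> : 1 + nodes A + nodes B + 1 = (nodes A + nodes B).+1 + 1 by lia.
have -> : 1 + nodes A + nodes B = (nodes A + nodes B).+1 by lia.
have -> : 1 + nodes A = nodes A + 1 by rewrite addnC.
by lia.
Qed.

Lemma balanced_range n w : balanced n w -> all (fun i => 0 < i <= n) w.
Proof.
move=> bw; rewrite (perm_all _ bw) all_cat andbb.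
by apply/allP => i; rewrite mem_iota; lia.
Qed.

Lemma balanced_last n w : balanced n w -> 0 < n -> 0 < last 0 w <= n.
Proof.
move=> bw n0; case/lastP: w bw => [/size_balanced /=|v p]; first by lia.
by move=> /balanced_range; rewrite all_rcons last_rcons => /andP[].
Qed.

Lemma balanced_next_min n w : balanced n w -> 0 < n -> 0 < next_min w.
Proof.
move=> bw n0; have := balanced_dup bw n0; have := balanced_range bw.
case/lastP: w {bw} => // v p; rewrite next_min_rcons last_rcons size_rcons /=.
rewrite -cats1 take_size_cat // all_cat => /andP[hv _].
rewrite has_filter -/(low p v).
case/lastP eV : (low p v) => [|u q] // _; rewrite last_rcons.
have : q \in low p v by rewrite eV mem_rcons inE eqxx.
by rewrite mem_filter => /andP[_ /(allP hv)/andP[]].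
Qed.

Lemma low_all a w : all (leq^~ a) w -> low a w = w.
Proof. by move=> h; apply/all_filterP. Qed.

Lemma low_none a w : all (ltn a) w -> low a w = [::].
Proof.
move=> /allP h; rewrite /low (@eq_in_filter _ _ pred0) ?filter_pred0 //.
by move=> i /h /=; rewrite ltnNge => /negbTE.
Qed.

Lemma high_none a w : all (leq^~ a) w -> high a w = [::].
Proof.
move=> /allP h; rewrite /high (@eq_in_filter _ _ pred0) ?filter_pred0 //.
by move=> i /h /=; rewrite leqNgt => /negbTE.
Qed.

Lemma high_map_addn a b w : a <= b -> all (ltn 0) w ->
  high a (map (addn b) w) = map (addn (b - a)) w.
Proof.
move=> ab /allP h; rewrite /high filter_map (@eq_in_filter _ _ predT).
  by rewrite filter_predT -map_comp; apply: eq_map => i /=; lia.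
by move=> i /h /= => i0; lia.
Qed.

Lemma tword_pos T : all (ltn 0) (tword T).
Proof. by apply: sub_all (balanced_range (balanced_tword T)) => i /andP[]. Qed.

Lemma tword_le T : all (leq^~ (nodes T)) (tword T).
Proof. by apply: sub_all (balanced_range (balanced_tword T)) => i /andP[]. Qed.

Lemma low_shifted_tword a b T : a <= b -> low a (map (addn b) (tword T)) = [::].
Proof.
move=> ab; rewrite low_none // all_map.
by apply: sub_all (tword_pos T) => i /=; lia.
Qed.

Lemma low_seq1 a i : a < i -> low a [:: i] = [::].
Proof. by move=> ai; rewrite low_none //= ai. Qed.

Lemma high0 n w : balanced n w -> high 0 w = w.
Proof.
move=> /balanced_range hw; rewrite /high map_id_in => [|i _]; last exact: subn0.
by apply/all_filterP; apply: sub_all hw => i /andP[].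
Qed.

(** * Cuts of the word of a tree *)

Section TreeWord.
Variables A B C : tree.
Let a := nodes A.
Let b := nodes B.
Let m := (a + b).+1.
Let w := tword (Node A B C).

Lemma last_tword : last 0 w = m.
Proof. by rewrite /w /= last_rcons. Qed.

Lemma high_tword a' : a' <= a -> high a' w =
  rcons (map (addn (a - a')) (tword B) ++ m - a' ::
         high a' (tword A) ++ map (addn (m - a')) (tword C)) (m - a').
Proof.
move=> a'a; rewrite /w /= -!cats1 !high_cat high_map_addn ?tword_pos //.
rewrite -cat1s !high_cat (high_map_addn _ (tword_pos C)); last by lia.
have -> : high a' [:: (nodes A + nodes B).+1] = [:: m - a'].
  by rewrite /high /= ifT //; lia.
by rewrite -!catA.
Qed.

(** The shifted letters of [tword C] exceed the last letter, so the last letter of the cut of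
    [tword A] counts or, if that cut is empty, the first copy of [m]. *)
Lemma next_min_high_tword a' : a' <= a ->
  next_min (high a' w) = last (m - a') (high a' (tword A)).
Proof.
move=> a'a; rewrite high_tword // next_min_rcons low_cat -cat1s !low_cat.
rewrite low_all; last first.
  by rewrite all_map; apply: sub_all (tword_le B) => i /=; lia.
rewrite [low _ [:: _]]low_all /= ?leqnn //.
rewrite [low _ (high _ _)]low_all; last first.
  have := balanced_range (balanced_high a' (balanced_tword A)).
  by apply: sub_all => i; lia.
by rewrite low_shifted_tword ?cats0 ?last_cat.
Qed.

(** This and the next lemmas recover the words of the subtrees by the successive cuts at [a], [b]
    and 1 that [tcoef_node] uses. *)
Lemma low_tword : low a w = tword A.
Proof.
rewrite /w /= -cats1 -cat1s !low_cat [low a (tword A)]low_all ?tword_le //.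
by rewrite !low_shifted_tword ?low_seq1 ?cats0 // /a; lia.
Qed.

Lemma high_tword0 :
  high a w = rcons (tword B ++ b.+1 :: map (addn b.+1) (tword C)) b.+1.
Proof.
rewrite high_tword // subnn high_none ?tword_le // map_id_in // cat0s.
by have -> : m - a = b.+1 by lia.
Qed.

Lemma low_high_tword : low b (high a w) = tword B.
Proof.
rewrite high_tword0 -cats1 -cat1s !low_cat [low b (tword B)]low_all ?tword_le //.
by rewrite !low_shifted_tword ?low_seq1 ?cats0.
Qed.

Lemma high_high_tword :
  high b (high a w) = rcons (1 :: map (addn 1) (tword C)) 1.
Proof.
rewrite high_tword0 -cats1 -cat1s !high_cat high_none ?tword_le //.
have -> : high b [:: b.+1] = [:: 1] by rewrite /high /= ltnSn /= subSnn.
by rewrite high_map_addn ?tword_pos // subSnn -cats1.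
Qed.

Lemma high_high_high_tword : high 1 (high b (high a w)) = tword C.
Proof.
rewrite high_high_tword -cats1 -cat1s !high_cat /= high_map_addn ?tword_pos //.
by rewrite subnn map_id_in //= cats0.
Qed.

End TreeWord.
Local Open Scope ring_scope.

Section TreeCoefficients.
Variable K : fieldType.
Local Notation FQ := (fqsym2 K).
Local Notation F11 := (F11 K).

Lemma coef0 w : coef (0 : FQ) w = 0.
Proof. by rewrite /coef; case: insub => // s; rewrite mcoeff0. Qed.

Definition hom_degree (a : nat) (u : FQ) :=
  forall n w, balanced n w -> coef u w != 0 -> n = a.

(** A cut [b < n] has a low part of degree [b], so it contributes only if [b = a]; a cut [b >= n]
    leaves an empty high part, where [v] vanishes. *)
Lemma has_cut_hom a (F u v : FQ) c n w : has_cut F u v c -> hom_degree a u ->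
  balanced n w ->
  coef F w = coef u (low a w) * coef v (high a w) * (c w a)%:R.
Proof.
move=> hF hu bw; rewrite (hF n w (maxn n a).+1) //; last first.
  by rewrite ltnW // ltnS leq_maxl.
rewrite (bigD1_seq a) ?iota_uniq ?mem_index_iota ?ltnS ?leq_maxr //=.
rewrite big1_seq ?addr0 // => b /andP[ba].
rewrite mem_index_iota /= ltnS leq_max => hb.
have [->|/(hu _ _ (balanced_low b bw)) e] := eqVneq (coef u (low b w)) 0.
  by rewrite !mul0r.
have bn : (n <= b)%N by move: hb ba; lia.
have /size0nil -> : size (high b w) = 0%N.
  by rewrite (size_balanced (balanced_high b bw)); lia.
by rewrite coef_nil mulr0 mul0r.
Qed.

Lemma hom_degree_opk k a b u v : hom_degree a u -> hom_degree b v ->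
  hom_degree (a + b) (opk k u v).
Proof.
move=> hu hv n w bw; rewrite (has_cut_hom (has_cut_opk k u v) hu bw).
rewrite !mulf_eq0 !negb_or => /andP[/andP[cu cv] _].
have := hu _ _ (balanced_low a bw) cu; have := hv _ _ (balanced_high a bw) cv.
lia.
Qed.

Lemma coef_F11 w : coef F11 w = (w == [:: 1; 1]%N)%:R.
Proof.
rewrite /coef; case: insubP => [s _ <-|]; last first.
  by case: eqP => // ->.
by rewrite mcoeffU eq_sym -val_eqE.
Qed.

Lemma coef_F11_balanced n w : balanced n w -> coef F11 w = (n == 1)%N%:R.
Proof.
move=> bw; rewrite coef_F11; congr (nat_of_bool _)%:R; apply/eqP/eqP => [e|n1].
  by have := size_balanced bw; rewrite e /=; lia.
have /eqP := size_balanced bw; rewrite n1.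
case: w bw => [|i [|j [|? ?]]] // /balanced_range; rewrite n1 /= => hij _.
by have [-> ->] : i = 1%N /\ j = 1%N by lia.
Qed.

Lemma hom_degree_F11 : hom_degree 1 F11.
Proof.
move=> n w bw; rewrite (coef_F11_balanced bw); case: (n =P 1%N) => // _.
by rewrite /= eqxx.
Qed.

Lemma hom_degree_ev T : hom_degree (nodes T) (ev F11 T).
Proof.
elim: T => [|A hA B hB C hC].
  by move=> n w _; rewrite coef0 eqxx.
rewrite ev_node.
have hy : hom_degree (nodes C).+1 (oprec F11 C).
  rewrite /oprec; case: ifP => lC.
    2: exact: (hom_degree_opk (k := Prec) hom_degree_F11 hC).
  by case: C lC {hC} => // _; exact: hom_degree_F11.
have hz : hom_degree (nodes B + (nodes C).+1) (osucc F11 B (oprec F11 C)).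
  rewrite /osucc; case: ifP => lB; last exact: (hom_degree_opk (k := Succ) hB hy).
  by case: B lB {hB} => // _; exact: hy.
rewrite /= -addnA -addnS -addnS /ocirc.
case: ifP => lA; last exact: (hom_degree_opk (k := Circ) hA hz).
by case: A lA {hA} => // _; exact: hz.
Qed.

(** A leaf stands here for a unit, with coefficient 1 on the empty word, which makes [tcoef_node]
    uniform in empty and nonempty subtrees. *)
Definition tcoef (T : tree) (w : seq nat) : K :=
  if is_leaf T then (w == [::])%:R else coef (ev F11 T) w.

(** The factor [0 < n] excludes the empty word, whose default last letter 0 satisfies the other
    condition. *)
Lemma tcoef_oprec C n w : balanced n w -> 
  coef (oprec F11 C) w = tcoef C (high 1 w) * ((0 < n) && (last 0 w <= 1))%N%:R.
Proof.
move=> bw; rewrite /oprec /tcoef; case: ifP => lC.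
  rewrite (coef_F11_balanced bw) -natrM mulnb; congr (_%:R).
  have := size_balanced (balanced_high 1 bw); rewrite -size_eq0 => ->.
  have := balanced_last bw; case: n bw => [|[|n]] bw; lia.
rewrite (has_cut_hom (has_cut_opk Prec F11 _) hom_degree_F11 bw).
rewrite (coef_F11_balanced (balanced_low 1 bw)) mulrC [RHS]mulrC.
rewrite mulrA -natrM mulnb; congr ((nat_of_bool _)%:R * _).
by rewrite andbC; congr (_ && _); lia.
Qed.

Lemma tcoef_osucc B y n w : balanced n w ->
  coef (osucc F11 B y) w =
  tcoef B (low (nodes B) w) * coef y (high (nodes B) w) *
  (nodes B < next_min w)%N%:R.
Proof.
move=> bw; rewrite /osucc /tcoef; case: ifP => lB; last first.
  exact: has_cut_hom (has_cut_opk Succ _ _) (@hom_degree_ev B) bw.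
case: B lB => // _; rewrite /= (low0 bw) eqxx mul1r (high0 bw).
case: n bw => [|n] bw; last by rewrite (balanced_next_min bw) ?mulr1.
by rewrite (size0nil (size_balanced bw)) coef_nil mul0r.
Qed.

Lemma tcoef_ocirc A z n w : balanced n w ->
  coef (ocirc F11 A z) w =
  tcoef A (low (nodes A) w) * coef z (high (nodes A) w) *
  (is_leaf A || (next_min w <= nodes A < last 0 w)%N)%:R.
Proof.
move=> bw; rewrite /ocirc /tcoef; case: ifP => lA; last first.
  exact: has_cut_hom (has_cut_opk Circ _ _) (@hom_degree_ev A) bw.
by case: A lA => // _; rewrite /= (low0 bw) eqxx mul1r (high0 bw) mulr1.
Qed.

Lemma tcoef_node A B C n w : balanced n w ->
  let wA := high (nodes A) w in let wB := high (nodes B) wA in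
  tcoef (Node A B C) w =
  tcoef A (low (nodes A) w) *
  (tcoef B (low (nodes B) wA) * tcoef C (high 1 wB)) *
  [&& is_leaf A || (next_min w <= nodes A < last 0 w)%N,
      (nodes B < next_min wA)%N, (nodes A + nodes B < n)%N & (last 0 wB <= 1)%N]%:R.
Proof.
move=> bw wA wB; have bA := balanced_high (nodes A) bw.
rewrite /tcoef [is_leaf (Node _ _ _)]/= ev_node.
rewrite (tcoef_ocirc A _ bw) (tcoef_osucc B _ bA).
rewrite (tcoef_oprec C (balanced_high (nodes B) bA)) -/wA -/wB -/(tcoef _ _).
rewrite -!mulnb !natrM -subnDA subn_gt0 /tcoef; ring.
Qed.

Lemma tcoef_degree T n w : balanced n w -> tcoef T w != 0 -> n = nodes T.
Proof.
move=> bw; rewrite /tcoef; case: ifP => lT; last exact: hom_degree_ev.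
case: T lT => // _; have := size_balanced bw.
case: (w =P [::]) => [-> /=|_]; first by lia.
by rewrite eqxx.
Qed.

Lemma tcoef_tword T : tcoef T (tword T) = 1.
Proof.
elim: T => [|A hA B hB C hC]; first by rewrite /tcoef eqxx.
rewrite (tcoef_node _ _ _ (balanced_tword _)) low_tword low_high_tword.
rewrite high_high_high_tword hA hB hC !mul1r.
rewrite last_tword next_min_high_tword // high_none ?tword_le //=.
rewrite high_high_tword last_rcons leqnn andbT.
have -> : next_min (tword (Node A B C)) =
    last (nodes A + nodes B).+1 (tword A).
  have := @next_min_high_tword A B C 0 isT; rewrite subn0.
  by rewrite !(high0 (balanced_tword _)).
have [lA|lA] := boolP (is_leaf A).
  by case: A lA {hA} => //= _; rewrite !subn0 ltnSn ltnS leq_addr.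
have A0 : (0 < nodes A)%N by rewrite lt0n nodes_eq0.
have := balanced_last (balanced_tword A) A0.
case/lastP: (tword A) => [|u q]; first by rewrite /=; lia.
rewrite !last_rcons => hq.
by rewrite [X in X%:R](_ : _ = 1%N) //=; lia.
Qed.

(** The conditions of [tcoef_node] at the word of [T] force the left subtree of [T'] to be at least
    as large as that of [T]; when the sizes agree, the cuts are the words of the subtrees and
    induction applies. *)
Lemma tcoef_triangular T T' :
  tcoef T' (tword T) != 0 -> T' = T \/ (rank T < rank T')%N.
Proof.
elim: T T' => [|A hA B hB C hC] T' hT'.
  have := tcoef_degree (balanced_tword Leaf) hT'.
  by case: T' {hT'} => //; left.
have bw := balanced_tword (Node A B C).
have sT' := tcoef_degree bw hT'.
case: T' sT' hT' => [|A' B' C'] //= sT'.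
rewrite (tcoef_node _ _ _ bw) !mulf_eq0 !negb_or => /andP[/andP[nA /andP[nB nC]]].
case: (boolP [&& _, _, _ & _]); last by rewrite /= eqxx.
move=> /and4P[cA cB cn cC] _.
set w := tword (Node A B C) in bw nA nB nC cA cB cn cC.
have lastw : last 0%N w = (nodes A + nodes B).+1 by exact: last_tword.
have lA : last 0%N (high (nodes A') w) = ((nodes A + nodes B).+1 - nodes A')%N.
  rewrite last_high lastw //; case/orP: cA => [|/andP[_]]; last by rewrite lastw.
  by rewrite -nodes_eq0 => /eqP ->.
have qA := next_min_le (high (nodes A') w).
have lB : last 0%N (high (nodes B') (high (nodes A') w)) =
    ((nodes A + nodes B).+1 - nodes A' - nodes B')%N.
  by rewrite last_high lA //; lia.
(* [cC] bounds the left side from below, [cB] with [qA] from above. *)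
have eAB : (nodes A' + nodes B' = nodes A + nodes B)%N.
  by move: cC cB qA; rewrite lB lA; lia.
have [ltA|ltA|eA] := ltngtP (nodes A) (nodes A').
- by right; apply: rank_node_lt; lia.
(* If $a'<a$, then [next_min] is a letter of a cut of [tword A], so it is at most $a-a'\le b'$,
   contradicting [cB]. *)
- have := next_min_high_tword B C (ltnW ltA); rewrite -/w => eq.
  have bA := balanced_high (nodes A') (balanced_tword A).
  have := balanced_last bA; rewrite subn_gt0 ltA => /(_ isT).
  move: cB; rewrite eq; case/lastP: (high _ (tword A)) => [|u q] /=; first by lia.
  by rewrite !last_rcons; lia.
have eB : nodes B' = nodes B by lia.
move: nA nB nC; rewrite -eA eB /w low_tword low_high_tword high_high_high_tword.
have eC : nodes C' = nodes C by lia.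
rewrite eC ltn_add2l => /hA[eqA|rA] /hB[eqB|rB] /hC[eqC|rC];
  by [left; rewrite eqA eqB eqC | right; rewrite ?eqA ?eqB ?eqC; lia].
Qed.

(** Descending induction on the rank, via the coefficient of [tword T]: other trees contribute only
    if their rank is larger, and their scalars are already known to be 0. *)
Lemma ev_F11_free (s : seq tree) (c : tree -> K) :
  uniq s -> Leaf \notin s -> \sum_(T <- s) c T *: ev F11 T = 0 ->
  forall T, T \in s -> c T = 0.
Proof.
move=> us lf e0; pose R := (\max_(T <- s) rank T)%N.
suff H d T : T \in s -> (R < rank T + d)%N -> c T = 0.
  by move=> T Ts; apply: (H R.+1) => //; lia.
elim: d T => [|d IHd] T Ts.
  by rewrite addn0 ltnNge /R leq_bigmax_seq.
move=> RT; have : coef (\sum_(T' <- s) c T' *: ev F11 T') (tword T) = 0.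
  by rewrite e0 coef0.
have sumE (r : seq tree) : coef (\sum_(T' <- r) c T' *: ev F11 T') (tword T) =
    \sum_(T' <- r) c T' * coef (ev F11 T') (tword T).
  elim: r => [|T' r IHr]; last by rewrite !big_cons coef_lin IHr.
  by rewrite !big_nil coef0.
have cE T' : T' \in s -> coef (ev F11 T') (tword T) = tcoef T' (tword T).
  by move=> T's; rewrite /tcoef -eq_leaf; case: eqP lf T's => // -> /negPf ->.
rewrite sumE (bigD1_seq T) //= big1_seq ?addr0 => [|T' /andP[T'T T's]].
  by rewrite cE // tcoef_tword mulr1.
rewrite cE //; have [->|/tcoef_triangular[/eqP|rT]] := eqVneq (tcoef T' (tword T)) 0.
- by rewrite mulr0.
- by rewrite (negPf T'T).
by rewrite (IHd T') ?mul0r //; lia.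
Qed.

End TreeCoefficients.
(** * Freeness and dimensions *)

Section Homomorphisms.
Variables (K : fieldType) (A B : triop K) (f : A -> B).
Hypothesis homf : is_dend2_hom f.

Lemma dend2_hom0 : f 0 = 0.
Proof.
by have := dend2_hom_linear homf (-1) 0 0; rewrite scaler0 addr0 scaleN1r addNr.
Qed.

Lemma dend2_hom_opk k u v : f (opk k u v) = opk k (f u) (f v).
Proof.
by case: homf => _ hp hc hs; case: k; [exact: hp | exact: hc | exact: hs].
Qed.

Lemma dend2_hom_ev x T : f (ev x T) = ev (f x) T.
Proof.
elim: T => [|T1 h1 T2 h2 T3 h3]; first exact: dend2_hom0.
rewrite !ev_node /ocirc /osucc /oprec.
case: (is_leaf T1); case: (is_leaf T2); case: (is_leaf T3);
  by rewrite ?(dend2_hom_circ homf) ?(dend2_hom_succ homf)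
             ?(dend2_hom_prec homf) ?h1 ?h2 ?h3.
Qed.

Lemma dend2_hom_evl x p : f (evl x p) = evl (f x) p.
Proof.
elim: p => [|c p IHp]; first by rewrite /evl !big_nil dend2_hom0.
by rewrite !evl_cons (dend2_hom_linear homf) IHp dend2_hom_ev.
Qed.

Lemma dend2_hom_sum_ev x (s : seq tree) (c : tree -> K) :
  f (\sum_(T <- s) c T *: ev x T) = \sum_(T <- s) c T *: ev (f x) T.
Proof.
elim: s => [|T s IHs]; first by rewrite !big_nil dend2_hom0.
by rewrite !big_cons (dend2_hom_linear homf) IHs dend2_hom_ev.
Qed.

End Homomorphisms.

Lemma dend2_hom_id (K : fieldType) (A : triop K) : is_dend2_hom (@id A).
Proof. by []. Qed.

Lemma dend2_hom_comp (K : fieldType) (A B C : triop K)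
    (g : B -> C) (f : A -> B) :
  is_dend2_hom g -> is_dend2_hom f -> is_dend2_hom (g \o f).
Proof.
move=> hg hf; split=> [a u v|u v|u v|u v] /=.
- by rewrite (dend2_hom_linear hf) (dend2_hom_linear hg).
- by rewrite (dend2_hom_prec hf) (dend2_hom_prec hg).
- by rewrite (dend2_hom_circ hf) (dend2_hom_circ hg).
- by rewrite (dend2_hom_succ hf) (dend2_hom_succ hg).
Qed.

Lemma free_dend2_isomorphic (K : fieldType) (A B : triop K) (x : A) (y : B) :
  is_free_dend2 x -> is_free_dend2 y -> dend2_isomorphic A B.
Proof.
move=> [dA freeA] [dB freeB].
have [f [hf fx _]] := freeA B y dB; have [g [hg gy _]] := freeB A x dA.
exists f; split=> //; exists g => [u|v].
  have [i [_ _ iE]] := freeA A x dA.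
  transitivity (i u); last by apply/esym/(iE id) => //; exact: dend2_hom_id.
  by apply: (iE (g \o f)); [exact: dend2_hom_comp | rewrite /= fx].
have [i [_ _ iE]] := freeB B y dB.
transitivity (i v); last by apply/esym/(iE id) => //; exact: dend2_hom_id.
by apply: (iE (f \o g)); [exact: dend2_hom_comp | rewrite /= gy].
Qed.

Section Subalgebra.
Variables (K : fieldType) (A : triop K) (x : A).

Lemma subalg_val_hom : is_dend2_hom (subalg_val (x := x) : subalg x -> A).
Proof. by split. Qed.

Lemma subalg_dend2 : is_dend2 A -> is_dend2 (subalg x).
Proof.
move=> dA; split.
- by split=> [v a u u'|u a v v']; apply: val_inj; rewrite /= ?precDl ?precDr.
- by split=> [v a u u'|u a v v']; apply: val_inj; rewrite /= ?circDl ?circDr.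
- by split=> [v a u u'|u a v v']; apply: val_inj; rewrite /= ?succDl ?succDr.
- by move=> u v w; apply: val_inj; exact: (dend2_pp dA).
- by move=> u v w; apply: val_inj; exact: (dend2_cp dA).
- by move=> u v w; apply: val_inj; exact: (dend2_sp dA).
- by move=> u v w; apply: val_inj; exact: (dend2_pc dA).
- by move=> u v w; apply: val_inj; exact: (dend2_cc dA).
- by move=> u v w; apply: val_inj; exact: (dend2_ss dA).
Qed.

Lemma subalg_span u : is_dend2 A -> in_subalg x u -> exists p, u = evl x p.
Proof.
move=> dA; have opk_span k p q : exists r, opk k (evl x p) (evl x q) = evl x r.
  by have [r [_ e]] := evl_opk k p q; exists r; exact: e.
elim=> [||a _ _ _ [p ->] _ [q ->]|_ _ _ [p ->] _ [q ->]|_ _ _ [p ->] _ [q ->]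
       |_ _ _ [p ->] _ [q ->]].
- by exists [:: (1, Node Leaf Leaf Leaf)]; rewrite evl1.
- by exists [::]; rewrite /evl big_nil.
- by exists (lin a p q); rewrite evl_lin.
- exact: (opk_span Prec).
- exact: (opk_span Circ).
- exact: (opk_span Succ).
Qed.

End Subalgebra.

Lemma evl_collect (K : fieldType) (A : triop K) (x : A) p (s : seq tree) :
  uniq s -> all (fun c => is_leaf c.2 || (c.2 \in s)) p ->
  Leaf \notin s ->
  evl x p = \sum_(T <- s) (\sum_(c <- p | c.2 == T) c.1) *: ev x T.
Proof.
move=> us hp lf; under eq_bigr do rewrite scaler_suml big_mkcond.
rewrite exchange_big; apply: eq_big_seq => c /(allP hp) hc /=.
have [lc|lc] := boolP (is_leaf c.2).
  rewrite big1_seq => [|T /andP[_ Ts]].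
    by case: c.2 lc => // _; rewrite scaler0.
  by case: eqP => // e; move: lc lf; rewrite -eq_leaf e => /eqP <-; rewrite Ts.
rewrite (negPf lc) in hc; rewrite (bigD1_seq c.2) //= eqxx big1 ?addr0 // => T.
by rewrite eq_sym => /negPf ->.
Qed.

(** By independence at [F11], the collected scalar of every nonempty tree in [p] is 0. Hence any
    relation at [F11] holds in all algebras. *)
Lemma evl_F11_eq0 (K : fieldType) p : evl (F11 K) p = 0 ->
  forall (A : triop K) (x : A), evl x p = 0.
Proof.
pose s := undup [seq T <- map snd p | ~~ is_leaf T].
have us : uniq s by exact: undup_uniq.
have hp : all (fun c => is_leaf c.2 || (c.2 \in s)) p.
  apply/allP => c cp; rewrite mem_undup mem_filter map_f // andbT.
  by case: (is_leaf c.2).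
have lf : Leaf \notin s by rewrite mem_undup mem_filter.
rewrite (evl_collect _ us hp lf) => /(ev_F11_free us lf) c0 A x.
rewrite (evl_collect _ us hp lf) big1_seq // => T /andP[_ /c0 ->].
by rewrite scale0r.
Qed.

Lemma evl_F11_inj (K : fieldType) p q : evl (F11 K) p = evl (F11 K) q ->
  forall (A : triop K) (x : A), evl x p = evl x q.
Proof.
move=> e A x; apply/eqP; rewrite -subr_eq0 -scaleN1r addrC -evl_lin.
by rewrite (@evl_F11_eq0 K) // evl_lin e scaleN1r addNr.
Qed.

Lemma Dp2_free (K : fieldType) : is_free_dend2 (Dp2_gen K).
Proof.
have dF := fqsym2_dend2 K; split=> [|B b dB]; first exact: subalg_dend2.
have valE (u : Dp2 K) : exists p, subalg_val u = evl (F11 K) p.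
  by apply: (subalg_span dF); apply/subalg_predP; exact: subalg_valP.
(* [f] evaluates at [b] some chosen expression of [u]; by [evl_F11_inj] the choice does not affect
   the value. *)
have [pp ppE] := choice valE; pose f (u : Dp2 K) : B := evl b (pp u).
have fE (u : Dp2 K) p : subalg_val u = evl (F11 K) p -> f u = evl b p.
  by move=> e; apply: evl_F11_inj; rewrite -ppE.
have fk k (u v : Dp2 K) : f (opk k u v) = opk k (f u) (f v).
  have [r [_ e]] := evl_opk k (pp u) (pp v); rewrite /f e //; apply: fE.
  by rewrite -e // -!ppE; exact: (dend2_hom_opk (subalg_val_hom _)).
exists f; split.
- split=> [a u v|||]; [|exact: (fk Prec)|exact: (fk Circ)|exact: (fk Succ)].
  by rewrite /f -evl_lin; apply: fE; rewrite evl_lin -!ppE.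
- by rewrite (@fE _ [:: (1, Node Leaf Leaf Leaf)]) evl1.
move=> g hg gx u; have -> : u = evl (Dp2_gen K) (pp u).
  apply: val_inj; rewrite /= ppE.
  by rewrite (dend2_hom_evl (subalg_val_hom _)).
rewrite (dend2_hom_evl hg) gx (fE _ (pp u)) //.
by rewrite (dend2_hom_evl (subalg_val_hom _)).
Qed.

(** * Bases of the homogeneous components *)

Section Dimension.
Variables (K : fieldType) (D : triop K) (x : D).

Lemma dend_monomial_ev T : ~~ is_leaf T -> dend_monomial x (nodes T) (ev x T).
Proof.
elim: T => [|A hA B hB C hC] // _; rewrite ev_node.
have hy : dend_monomial x (nodes C).+1 (oprec x C).
  rewrite /oprec; have [lC|lC] := boolP (is_leaf C).
    by case: C lC {hC} => // _; exact: dend_monomial_gen.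
  by apply: (dend_monomial_prec (dend_monomial_gen x)); exact: hC.
have hz : dend_monomial x (nodes B + (nodes C).+1) (osucc x B (oprec x C)).
  rewrite /osucc; have [lB|lB] := boolP (is_leaf B).
    by case: B lB {hB} => // _; exact: hy.
  by apply: dend_monomial_succ => //; exact: hB.
rewrite /= -addnA -addnS -addnS /ocirc; have [lA|lA] := boolP (is_leaf A).
  by case: A lA {hA} => // _; exact: hz.
by apply: dend_monomial_circ => //; exact: hA.
Qed.

Lemma homogeneous_span n u : is_dend2 D -> homogeneous x n u ->
  exists2 p, pol n p & u = evl x p.
Proof.
move=> dD; elim=> [|a {}u v hu _ [q hq ->]].
  by exists [::]; rewrite /evl ?big_nil.
suff [p hp ->] : exists2 p, pol n p & u = evl x p.
  by exists (lin a p q); [exact: pol_lin | rewrite evl_lin].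
have opk_span k m1 m2 p q' : pol m1 p -> pol m2 q' ->
    exists2 r, pol (m1 + m2) r & opk k (evl x p) (evl x q') = evl x r.
  move=> hp hq'; have [r [hr e]] := evl_opk k p q'.
  by exists r; [exact: hr | exact: e].
elim: hu => [|m1 m2 _ _ _ [p hp ->] _ [q' hq' ->]|m1 m2 _ _ _ [p hp ->] _ [q' hq' ->]
            |m1 m2 _ _ _ [p hp ->] _ [q' hq' ->]].
- by exists [:: (1, Node Leaf Leaf Leaf)]; rewrite // evl1.
- exact: (opk_span Prec).
- exact: (opk_span Circ).
- exact: (opk_span Succ).
Qed.

Lemma lin_span_sum (S : D -> Prop) I (r : seq I) (c : I -> K) (F : I -> D) :
  (forall i, S (F i)) -> lin_span S (\sum_(i <- r) c i *: F i).
Proof.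
move=> SF; elim: r => [|i r IHr]; first by rewrite big_nil; exact: lin_span0.
by rewrite big_cons; apply: lin_spanD.
Qed.

(** Trees span by [homogeneous_span]. The universal property sends a relation between them to the
    same relation at [F11], where it is trivial. *)
Lemma free_has_dim n : is_free_dend2 x -> (0 < n)%N ->
  has_dim (homogeneous x n) (fuss_catalan2 n).
Proof.
move=> [dD freeD] n0; have lf : Leaf \notin trees n by rewrite mem_trees /=; lia.
have sumE (c : nat -> K) (A : triop K) (y : A) :
    \sum_(i < fuss_catalan2 n) c i *: ev y (nth Leaf (trees n) i) =
    \sum_(T <- trees n) c (index T (trees n)) *: ev y T.
  rewrite [RHS](big_nth Leaf) size_trees big_mkord; apply: eq_bigr => i _.
  by rewrite index_uniq ?uniq_trees // size_trees.
(* Scalars are extended by 0 to all naturals, so that they can be read at the index of a tree as in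
   [sumE]. *)
have ext (c : 'I_(fuss_catalan2 n) -> K) :
    exists c' : nat -> K, forall i, c i = c' i.
  exists (fun k => oapp c 0 (insub k)) => i; by rewrite valK.
exists (fun i => ev x (nth Leaf (trees n) i)); split=> [c|v].
  have [c' cE] := ext c; under eq_bigr do rewrite cE.
  have [f [hf fx _]] := freeD _ (F11 K) (fqsym2_dend2 K).
  rewrite sumE => e0 i; have {e0} := congr1 f e0.
  rewrite (dend2_hom_sum_ev hf _ _ (fun T => c' (index T (trees n)))) fx.
  rewrite (dend2_hom0 hf) => /(ev_F11_free (uniq_trees n) lf) h.
  have := h (nth Leaf (trees n) i); rewrite mem_nth ?size_trees // => /(_ isT).
  by rewrite index_uniq ?uniq_trees ?size_trees // cE.
split=> [/(homogeneous_span dD)[p hp ->]|[c ->]].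
  rewrite (@evl_collect _ _ _ _ (trees n)) ?uniq_trees //; last first.
    by apply: sub_all hp => c; rewrite mem_trees.
  exists (fun i => \sum_(c <- p | c.2 == nth Leaf (trees n) i) c.1).
  rewrite (sumE (fun i => \sum_(c <- p | c.2 == nth Leaf (trees n) i) c.1)).
  by apply: eq_big_seq => T Tn; rewrite nth_index.
apply: lin_span_sum => i.
have : nth Leaf (trees n) i \in trees n by rewrite mem_nth ?size_trees.
rewrite mem_trees => /eqP {1}<-; apply: dend_monomial_ev.
rewrite -eq_leaf; apply: contra lf => /eqP <-; rewrite mem_nth ?size_trees //.
Qed.

End Dimension.

Local Close Scope ring_scope.

Theorem theorem3p8 (K : fieldType) (hK : [pchar K]%R =i pred0) :
  (forall (D : triop K) (x : D), is_free_dend2 x ->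
     forall n : nat, 1 <= n -> has_dim (homogeneous x n) (fuss_catalan2 n)) /\
  is_free_dend2 (Dp2_gen K) /\
  (forall (D : triop K) (x : D), is_free_dend2 x ->
     dend2_isomorphic (Dp2 K) D).
Proof.
split; [|split]; first by move=> D x xfree n; exact: free_has_dim.
  exact: Dp2_free.
move=> D x; exact: free_dend2_isomorphic (Dp2_free K).
Qed.
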